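(* Let $k\in\{0,1,2,\dots\}$, $0<\alpha\le 1$, $0<\beta\le 1$, $\lambda\ge 0$, $\delta\ge 0$, $\gamma\ge 0$, and let $\phi(z)=1+B_1z+B_2z^2+B_3z^3+\cdots$ ($z\in U$) with $B_1>0$. Let $f(z)=z+\sum_{n\ge2}a_nz^n$ belong to the class $B^{k,\alpha,\beta,\delta,\lambda}_{\Sigma}(\gamma,\phi)$. Then $$|a_2|\le\frac{B_1\sqrt{2B_1}}{\sqrt{\left|B_1^2\left(2(\gamma+2)\Upsilon_3^kC(\delta,3)+(\gamma-1)(\gamma+2)[\Upsilon_2^kC(\delta,2)]^2\right)-2(B_2-B_1)(\gamma+1)^2[\Upsilon_2^kC(\delta,2)]^2\right|}}$$ and $$|a_3|\le\frac{B_1}{(\gamma+2)\Upsilon_3^kC(\delta,3)}+\left[\frac{B_1}{(\gamma+1)\Upsilon_2^kC(\delta,2)}\right]^2.$$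
   Context: $U=\{z\in\mathbb{C}:|z|<1\}$; $A$ is the class of functions $f(z)=z+\sum_{n\ge2}a_nz^n$ analytic in $U$. A function $f\in A$ is bi-univalent, written $f\in\Sigma$, if $f$ is univalent in $U$ and its inverse $f^{-1}$ (analytic near $0$) extends to a univalent analytic function $g$ on $U$; $g(w)=w-a_2w^2+(2a_2^2-a_3)w^3+\cdots$. For $F,G$ analytic in $U$, $F\prec G$ means $F=G\circ\omega$ for some analytic $\omega:U\to U$ with $\omega(0)=0$. Put $\Upsilon_n^k=[\lambda(\alpha+\beta-1)(n-1)]^k$ (equal to $1$ when $k=0$) and $C(\delta,n)=\binom{n+\delta-1}{\delta}=\frac{\Gamma(n+\delta)}{\Gamma(\delta+1)\Gamma(n)}$. For $h(z)=z+\sum_{n\ge2}c_nz^n\in A$ set $D^k_{\alpha,\beta,\delta,\lambda}h(z)=z+\sum_{n\ge2}\Upsilon_n^kC(\delta,n)c_nz^n$. $f\in\Sigma$ is in $B^{k,\alpha,\beta,\delta,\lambda}_\Sigma(\gamma,\phi)$ if, with $D=D^k_{\alpha,\beta,\delta,\lambda}$ and $g$ the extended inverse of $f$, $$\frac{z^{1-\gamma}(Df(z))'}{[Df(z)]^{1-\gamma}}\prec\phi(z)\quad\text{and}\quad\frac{w^{1-\gamma}(Dg(w))'}{[Dg(w)]^{1-\gamma}}\prec\phi(w),\qquad z,w\in U.$$ Here $\frac{z^{1-\gamma}F'(z)}{F(z)^{1-\gamma}}$ means $F'(z)\,(F(z)/z)^{\gamma-1}$, with the analytic branch of the power equal to $1$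 at $z=0$.
   Formalization: The bound on |a_3| is stated only when Υ_3^k > 0 (its right side is undefined if Υ_3^k = 0, and the bound fails for f(z)=z, small B_1, if Υ_3^k < 0); the bound on |a_2| is stated only when the expression under the modulus in its denominator is nonzero. *)

(* Defs.v *)
From Stdlib Require Import Reals.
From Coquelicot Require Import Coquelicot.

Open Scope R_scope.

Definition disc (r : R) (z : C) : Prop := Cmod z < r.

Definition U : C -> Prop := disc 1.

Definition C_psum (c : nat -> C) (z l : C) : Prop :=
  @is_pseries C_AbsRing C_NormedModule c z l.

Definition analytic_in (D : C -> Prop) (F : C -> C) : Prop :=
  forall z0 : C, D z0 ->
    exists (c : nat -> C) (r : posreal),
      forall z : C, Cmod (z - z0) < r -> C_psum c (z - z0)%C (F z).

Definition univalent (F : C -> C) : Prop :=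
  forall z w : C, U z -> U w -> F z = F w -> z = w.

(* The class A: [h] is analytic in [U] with expansion
   z + c_2 z^2 + c_3 z^3 + ... there.  Functions are total on [C]; their values
   outside [U] are never used. *)
Definition class_A (h : C -> C) (c : nat -> C) : Prop :=
  c 0%nat = RtoC 0 /\ c 1%nat = RtoC 1 /\
  forall z : C, U z -> C_psum c z (h z).

(* [g] agrees near 0 with the inverse f^{-1} : f(U) -> U. *)
Definition extended_inverse (f g : C -> C) : Prop :=
  analytic_in U g /\ univalent g /\
  exists r : posreal, forall z : C, U z -> Cmod (f z) < r -> g (f z) = z.

Definition bi_univalent (f : C -> C) : Prop :=
  (exists a : nat -> C, class_A f a) /\ univalent f /\
  exists g : C -> C, extended_inverse f g.

Definition subordinate (F G : C -> C) : Prop :=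
  exists w : C -> C,
    analytic_in U w /\ w (RtoC 0) = RtoC 0 /\
    forall z : C, U z -> U (w z) /\ F z = G (w z).

(* Euler's integral; only used at arguments >= 1. *)
Definition Gamma (x : R) : R :=
  RInt_gen (fun t : R => Rpower t (x - 1) * exp (- t))
    (at_right 0) (Rbar_locally p_infty).

Definition Cbin (delta : R) (n : nat) : R :=
  Gamma (INR n + delta) / (Gamma (delta + 1) * Gamma (INR n)).

Definition Upsilon (alpha beta lambda : R) (k n : nat) : R :=
  (lambda * (alpha + beta - 1) * (INR n - 1)) ^ k.

Definition D_coef (k : nat) (alpha beta delta lambda : R) (c : nat -> C)
    (n : nat) : C :=
  match n with
  | 0%nat => RtoC 0
  | 1%nat => RtoC 1
  | _ => (RtoC (Upsilon alpha beta lambda k n * Cbin delta n) * c n)%C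
  end.

(* [F] is the function D^k_{alpha,beta,delta,lambda} h on [U]. *)
Definition D_image (k : nat) (alpha beta delta lambda : R) (h F : C -> C)
    : Prop :=
  exists c : nat -> C,
    class_A h c /\
    forall z : C, U z -> C_psum (D_coef k alpha beta delta lambda c) z (F z).

Definition Cexp (z : C) : C := (exp (Re z) * cos (Im z), exp (Re z) * sin (Im z)).

(* [P] is the analytic branch on [U] of (F(z)/z)^s equal to 1 at 0: near 0 it is
   exp (s * log (F(z)/z)), with log (F(z)/z) the analytic logarithm [L] vanishing
   at 0, and it is analytic in all of [U].  Prescribing the germ at 0 rather
   than a logarithm on [U] keeps the cases in which the power makes sense although
   F(z)/z has zeros in [U], e.g. s = 0. *)
Definition power_branch (s : R) (F P : C -> C) : Prop :=
  analytic_in U P /\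
  exists (r : posreal) (L : C -> C),
    analytic_in (disc r) L /\ L (RtoC 0) = RtoC 0 /\
    forall z : C, disc r z ->
      F z = (z * Cexp (L z))%C /\ P z = Cexp (RtoC s * L z)%C.

(* z^{1-gamma} F'(z) / F(z)^{1-gamma} is subordinate to [phi]. *)
Definition power_quotient_subordinate (gamma : R) (F phi : C -> C) : Prop :=
  exists P : C -> C,
    power_branch (gamma - 1) F P /\
    subordinate (fun z => (C_derive F z * P z)%C) phi.

Definition class_B (k : nat) (alpha beta delta lambda gamma : R)
    (phi f : C -> C) : Prop :=
  bi_univalent f /\
  exists g Df Dg : C -> C,
    extended_inverse f g /\
    D_image k alpha beta delta lambda f Df /\
    D_image k alpha beta delta lambda g Dg /\
    power_quotient_subordinate gamma Df phi /\
    power_quotient_subordinate gamma Dg phi.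

(* Main.v *)
Require Import Defs.
From Stdlib Require Import Reals Lra Lia List Classical IndefiniteDescription.
From Coquelicot Require Import Coquelicot.
Open Scope R_scope.

(** Write [u], [v] for the Schwarz functions of the two subordinations.  Comparing
    the coefficients of [z] and [z^2] gives, with [T_n = Upsilon_n^k C(delta, n)],
    [(gamma+1) T2 a2 = B1 u1] and
    [(gamma+2) T3 a3 + (gamma-1)(gamma+2)/2 T2^2 a2^2 = B1 u2 + B2 u1^2], and the
    same relations for [v] with [(a2, a3)] replaced by [(-a2, 2 a2^2 - a3)], the
    coefficients of the inverse.  Hence [v1 = -u1],
    [E a2^2 = B1^3 (u2 + v2 + 2 u1^2)] and
    [2 (gamma+2) T3 (a3 - a2^2) = B1 (u2 - v2)], so everything follows from
    [|u2| <= 1 - |u1|^2], the Schwarz-Pick inequality at 0 for [u(z) / z].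

    Analyticity is only given through local power series.  The proof of Schwarz-Pick
    replaces it by Taylor expansions of all orders at each point: these are
    immediately stable under products, inverses and division by [z], and they
    suffice for the maximum modulus principle. *)

Local Notation near0 := (locally (RtoC 0)).

Lemma locally_Cmod (z : C) (P : C -> Prop) :
  locally z P <-> exists d : R, 0 < d /\ forall x, Cmod (x - z) < d -> P x.
Proof.
  split.
  - intros H. apply locally_C in H. destruct H as [d H].
    exists d. split; [apply cond_pos | exact H].
  - intros (d & Hd & H). apply locally_C. exists (mkposreal d Hd). exact H.
Qed.

Lemma near0_Cmod (P : C -> Prop) :
  near0 P <-> exists d : R, 0 < d /\ forall z, Cmod z < d -> P z.
Proof.
  rewrite locally_Cmod.
  split; intros (d & Hd & H); exists d; (split; [assumption|]); intros z Hz; apply H.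
  - replace (z - 0)%C with z by ring. assumption.
  - replace z with (z - 0)%C by ring. assumption.
Qed.

Lemma near0_forall (P : C -> Prop) : (forall z, P z) -> near0 P.
Proof. exact (filter_forall P). Qed.

Lemma near0_imp (P Q : C -> Prop) : (forall z, P z -> Q z) -> near0 P -> near0 Q.
Proof. exact (filter_imp P Q). Qed.

Lemma locally_translate (z : C) (P : C -> Prop) :
  near0 (fun h => P (z + h)%C) <-> locally z P.
Proof.
  rewrite near0_Cmod, locally_Cmod.
  split; intros (d & Hd & H); exists d; (split; [assumption|]); intros x Hx.
  - replace x with (z + (x - z))%C by ring. now apply H.
  - apply H. now replace (z + x - z)%C with x by ring.
Qed.

Lemma Cmod_R_pos_eq (t : R) : 0 <= t -> Cmod t = t.
Proof. rewrite Cmod_R. apply Rabs_pos_eq. Qed.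

Lemma Rle_of_small_error (x y K r : R) :
  0 < r -> (forall s, 0 < s < r -> x <= y + K * s) -> x <= y.
Proof.
  intros Hr H.
  assert (HK : 0 <= Rabs K) by apply Rabs_pos.
  apply le_epsilon. intros e He.
  set (s := Rmin (r / 2) (e / (Rabs K + 1))).
  assert (Hs : 0 < s) by (apply Rmin_pos; [|apply Rdiv_lt_0_compat]; lra).
  assert (Hsr : s <= r / 2) by apply Rmin_l.
  assert (Hse : s * (Rabs K + 1) <= e) by (apply Rle_div_r; [lra | apply Rmin_r]).
  specialize (H s ltac:(lra)). assert (HKK := Rle_abs K). nra.
Qed.

(** * Taylor expansions at 0 *)

Definition bounded_near_0 (F : C -> C) : Prop :=
  exists K : R, near0 (fun z => Cmod (F z) <= K).

Lemma bounded_near_0_ext (F G : C -> C) :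
  near0 (fun z => F z = G z) -> bounded_near_0 F -> bounded_near_0 G.
Proof.
  intros HFG [K HK]. exists K. generalize (filter_and _ _ HFG HK).
  apply near0_imp. now intros z [<- H].
Qed.

Lemma bounded_near_0_const (c : C) : bounded_near_0 (fun _ => c).
Proof. exists (Cmod c). apply filter_forall. intros; lra. Qed.

Lemma bounded_near_0_id : bounded_near_0 (fun z => z).
Proof. exists 1. apply near0_Cmod. exists 1. split; [lra|]. intros; lra. Qed.

Lemma bounded_near_0_plus (F G : C -> C) :
  bounded_near_0 F -> bounded_near_0 G -> bounded_near_0 (fun z => F z + G z)%C.
Proof.
  intros [K HF] [L HG]. exists (K + L). generalize (filter_and _ _ HF HG).
  apply near0_imp. intros z [Fz Gz].
  eapply Rle_trans; [apply Cmod_triangle | lra].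
Qed.

Lemma bounded_near_0_mult (F G : C -> C) :
  bounded_near_0 F -> bounded_near_0 G -> bounded_near_0 (fun z => F z * G z)%C.
Proof.
  intros [K HF] [L HG]. exists (K * L). generalize (filter_and _ _ HF HG).
  apply near0_imp. intros z [Fz Gz]. rewrite Cmod_mult.
  apply Rmult_le_compat; auto using Cmod_ge_0.
Qed.

Lemma bounded_near_0_comp {F w : C -> C} :
  bounded_near_0 F -> filterlim w near0 near0 -> bounded_near_0 (fun z => F (w z)).
Proof. intros [K HF] Hw. exists K. exact (Hw _ HF). Qed.

Create HintDb bounded.
#[local] Hint Resolve bounded_near_0_const bounded_near_0_id bounded_near_0_plus
  bounded_near_0_mult : bounded.

Lemma bounded_remainder_continuous {F G : C -> C} {c : C} :
  bounded_near_0 G -> near0 (fun z => F z = c + z * G z)%C ->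
  F 0 = c /\ filterlim F near0 (locally c).
Proof.
  intros [K HG] HF. split.
  - rewrite (locally_singleton _ _ HF). ring.
  - intros P HP. apply locally_Cmod in HP. destruct HP as (e & He & HP).
    assert (HK : 0 <= K)
      by (eapply Rle_trans; [apply Cmod_ge_0 | exact (locally_singleton _ _ HG)]).
    assert (Hsmall : near0 (fun z => Cmod z * (K + 1) < e)).
    { apply near0_Cmod. exists (e / (K + 1)). split; [apply Rdiv_lt_0_compat; lra|].
      intros z Hz. apply Rlt_div_r; lra. }
    unfold filtermap. generalize (filter_and _ _ Hsmall (filter_and _ _ HG HF)).
    apply near0_imp. intros z (Hz & Gz & ->). apply HP.
    replace (c + z * G z - c)%C with (z * G z)%C by ring. rewrite Cmod_mult.
    assert (z_ge_0 := Cmod_ge_0 z). nra.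
Qed.

Lemma bounded_remainder_eq0 (G : C -> C) (c : C) :
  bounded_near_0 G -> near0 (fun z => z * (c + z * G z) = 0)%C -> c = 0.
Proof.
  intros [K HG] H. generalize (filter_and _ _ HG H). intros Hloc.
  apply near0_Cmod in Hloc. destruct Hloc as (d & Hd & Hloc).
  apply Cmod_eq_0. apply Rle_antisym; [|apply Cmod_ge_0].
  apply (Rle_of_small_error _ _ K d Hd). intros t Ht.
  assert (Hm : Cmod t = t) by (apply Cmod_R_pos_eq; lra).
  destruct (Hloc t ltac:(lra)) as [Gt Et].
  assert (Ht0 : RtoC t <> 0) by (apply Cmod_gt_0; lra).
  assert (Ec : c = (- (t * G t))%C).
  { replace c with (/ t * (t * (c + t * G t)) - t * G t)%C by now field.
    rewrite Et. ring. }
  rewrite Ec, Cmod_opp, Cmod_mult, Hm. nra.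
Qed.

Lemma bounded_remainder_unique {F G : C -> C} {c d : C} :
  bounded_near_0 F -> bounded_near_0 G ->
  near0 (fun z => z * (c + z * F z) = z * (d + z * G z))%C ->
  c = d /\ near0 (fun z => z * F z = z * G z)%C.
Proof.
  intros BF BG H.
  assert (Ecd : c = d).
  { replace c with (c + (-1) * d + d)%C by ring.
    rewrite (bounded_remainder_eq0 (fun z => F z + (-1) * G z)%C (c + (-1) * d)%C);
      [ring | auto with bounded|].
    revert H. apply near0_imp. intros z E.
    transitivity (z * (c + z * F z) - z * (d + z * G z))%C; [ring|].
    rewrite E. ring. }
  subst d. split; [reflexivity|]. revert H. apply near0_imp. intros z E.
  destruct (Ceq_dec z 0) as [->|Hz]; [ring|].
  transitivity (/ z * (z * (c + z * F z)) - c)%C; [now field|].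
  rewrite E. now field.
Qed.

Fixpoint taylor (n : nat) (F : C -> C) : Prop :=
  match n with
  | 0%nat => bounded_near_0 F
  | S m => exists (c : C) (G : C -> C),
      taylor m G /\ near0 (fun z => F z = c + z * G z)%C
  end.

Lemma taylor_ext (n : nat) (F G : C -> C) :
  near0 (fun z => F z = G z) -> taylor n F -> taylor n G.
Proof.
  intros HFG. destruct n as [|n]; [now apply bounded_near_0_ext|].
  intros (c & H & TH & HF). exists c, H. split; [assumption|].
  generalize (filter_and _ _ HFG HF). apply near0_imp. now intros z [<- E].
Qed.

Lemma taylor_pred (n : nat) (F : C -> C) : taylor (S n) F -> taylor n F.
Proof.
  revert F. induction n as [|n IH]; intros F (c & G & TG & HF).
  - apply (bounded_near_0_ext (fun z => c + z * G z)%C); [|auto with bounded].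
    revert HF. apply near0_imp. auto.
  - exists c, G. auto.
Qed.

Lemma taylor_bounded (n : nat) (F : C -> C) : taylor n F -> bounded_near_0 F.
Proof. induction n as [|n IH]; [trivial|]. intros TF. now apply IH, taylor_pred. Qed.

Lemma taylor_const (n : nat) (c : C) : taylor n (fun _ => c).
Proof.
  revert c. induction n as [|n IH]; intros c; [apply bounded_near_0_const|].
  exists c, (fun _ => RtoC 0). split; [apply IH|].
  apply near0_forall. intros; ring.
Qed.

Lemma taylor_id (n : nat) : taylor n (fun z => z).
Proof.
  destruct n as [|n]; [apply bounded_near_0_id|].
  exists (RtoC 0), (fun _ => RtoC 1). split; [apply taylor_const|].
  apply near0_forall. intros; ring.
Qed.

Lemma taylor_plus (n : nat) (F G : C -> C) :
  taylor n F -> taylor n G -> taylor n (fun z => F z + G z)%C.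
Proof.
  revert F G. induction n as [|n IH]; intros F G; [apply bounded_near_0_plus|].
  intros (c & F1 & TF & HF) (d & G1 & TG & HG).
  exists (c + d)%C, (fun z => F1 z + G1 z)%C. split; [auto|].
  generalize (filter_and _ _ HF HG). apply near0_imp. intros z [-> ->]. ring.
Qed.

Lemma taylor_mult (n : nat) (F G : C -> C) :
  taylor n F -> taylor n G -> taylor n (fun z => F z * G z)%C.
Proof.
  revert F G. induction n as [|n IH]; intros F G; [apply bounded_near_0_mult|].
  intros (c & F1 & TF & HF) TG. assert (TG' := taylor_pred n G TG).
  destruct TG as (d & G1 & TG1 & HG).
  exists (c * d)%C, (fun z => c * G1 z + F1 z * G z)%C. split.
  - apply taylor_plus; apply IH; auto using taylor_const.
  - generalize (filter_and _ _ HF HG). apply near0_imp. intros z [-> Gz].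
    rewrite Gz. ring.
Qed.

Lemma filterlim_inv_bounded (F : C -> C) (c : C) :
  c <> 0 -> filterlim F near0 (locally c) ->
  near0 (fun z => F z <> 0 /\ Cmod (/ F z) <= / (Cmod c / 2)).
Proof.
  intros Hc HF. apply Cmod_gt_0 in Hc.
  assert (Hnear : locally c (fun x => Cmod c / 2 < Cmod x)).
  { apply locally_Cmod. exists (Cmod c / 2). split; [lra|]. intros x Hx.
    assert (Htri := Cmod_triangle x (- (x - c))).
    replace (x + - (x - c))%C with c in Htri by ring.
    rewrite Cmod_opp in Htri. lra. }
  specialize (HF _ Hnear). unfold filtermap in HF. revert HF.
  apply near0_imp. intros z Hz.
  assert (Fz : F z <> 0) by (apply Cmod_gt_0; lra).
  split; [assumption|]. rewrite Cmod_inv by assumption.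
  apply Rinv_le_contravar; lra.
Qed.

Lemma taylor_inv (F : C -> C) :
  (forall n, taylor n F) -> F 0 <> 0 -> forall n, taylor n (fun z => / F z)%C.
Proof.
  intros TF HF0 n.
  assert (Hinv : near0 (fun z => F z <> 0 /\ Cmod (/ F z) <= / (Cmod (F 0) / 2))).
  { destruct (TF 1%nat) as (c & G & BG & HF).
    destruct (bounded_remainder_continuous BG HF) as [E0 Hlim].
    rewrite <- E0 in Hlim. now apply filterlim_inv_bounded. }
  induction n as [|n IH].
  - exists (/ (Cmod (F 0) / 2)). revert Hinv. apply near0_imp. tauto.
  - destruct (TF (S n)) as (c & G & TG & HF).
    assert (Hc : c = F 0) by (rewrite (locally_singleton _ _ HF); ring).
    exists (/ c)%C, (fun z => - / c * (G z * / F z))%C. split.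
    + apply taylor_mult; [apply taylor_const | now apply taylor_mult].
    + generalize (filter_and _ _ Hinv HF). apply near0_imp.
      intros z [[Fz _] E]. rewrite <- Hc in HF0.
      replace (z * (- / c * (G z * / F z)))%C with (- (z * G z) * / (c * F z))%C
        by now field.
      replace (z * G z)%C with (F z - c)%C by (rewrite E; ring). now field.
Qed.

Definition jet2 (F : C -> C) (c0 c1 c2 : C) : Prop :=
  exists G : C -> C, bounded_near_0 G /\
    near0 (fun z => F z = c0 + z * (c1 + z * (c2 + z * G z)))%C.

Lemma taylor_jet2 (F : C -> C) : taylor 3 F -> exists c0 c1 c2 : C, jet2 F c0 c1 c2.
Proof.
  intros (c0 & F1 & (c1 & F2 & (c2 & G & BG & H2) & H1) & H0).
  exists c0, c1, c2, G. split; [assumption|].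
  generalize (filter_and _ _ H0 (filter_and _ _ H1 H2)). apply near0_imp.
  intros z (-> & -> & ->). reflexivity.
Qed.

Lemma jet2_ext (F G : C -> C) (c0 c1 c2 : C) :
  near0 (fun z => F z = G z) -> jet2 F c0 c1 c2 -> jet2 G c0 c1 c2.
Proof.
  intros HFG (H & BH & HF). exists H. split; [assumption|].
  generalize (filter_and _ _ HFG HF). apply near0_imp. now intros z [<- E].
Qed.

Lemma jet2_continuous {F : C -> C} {c0 c1 c2 : C} :
  jet2 F c0 c1 c2 -> F 0 = c0 /\ filterlim F near0 (locally c0).
Proof.
  intros (G & BG & HF). revert HF. apply bounded_remainder_continuous.
  auto with bounded.
Qed.

Lemma jet2_unique_off_0 {F G : C -> C} {c0 c1 c2 d0 d1 d2 : C} :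
  near0 (fun z => z * F z = z * G z)%C ->
  jet2 F c0 c1 c2 -> jet2 G d0 d1 d2 -> c0 = d0 /\ c1 = d1 /\ c2 = d2.
Proof.
  intros HFG (F3 & BF & HF) (G3 & BG & HG).
  assert (Heq : near0 (fun z => z * (c0 + z * (c1 + z * (c2 + z * F3 z)))
                                = z * (d0 + z * (d1 + z * (d2 + z * G3 z))))%C).
  { generalize (filter_and _ _ HFG (filter_and _ _ HF HG)).
    apply near0_imp. now intros z (E & <- & <-). }
  apply bounded_remainder_unique in Heq; [|auto with bounded..].
  destruct Heq as [E0 Heq].
  apply bounded_remainder_unique in Heq; [|auto with bounded..].
  destruct Heq as [E1 Heq].
  apply bounded_remainder_unique in Heq; [|assumption..]. tauto.
Qed.

Lemma jet2_unique {F : C -> C} {c0 c1 c2 d0 d1 d2 : C} :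
  jet2 F c0 c1 c2 -> jet2 F d0 d1 d2 -> c0 = d0 /\ c1 = d1 /\ c2 = d2.
Proof. now apply jet2_unique_off_0, near0_forall. Qed.

Lemma jet2_eq {F : C -> C} {c0 c1 c2 d0 d1 d2 : C} :
  c0 = d0 -> c1 = d1 -> c2 = d2 -> jet2 F c0 c1 c2 -> jet2 F d0 d1 d2.
Proof. now intros -> -> ->. Qed.

Lemma jet2_const (c : C) : jet2 (fun _ => c) c 0 0.
Proof.
  exists (fun _ => RtoC 0). split; [auto with bounded|].
  apply near0_forall. intros; ring.
Qed.

Lemma jet2_id : jet2 (fun z => z) 0 1 0.
Proof.
  exists (fun _ => RtoC 0). split; [auto with bounded|].
  apply near0_forall. intros; ring.
Qed.

Lemma jet2_plus {F G : C -> C} {c0 c1 c2 d0 d1 d2 : C} :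
  jet2 F c0 c1 c2 -> jet2 G d0 d1 d2 ->
  jet2 (fun z => F z + G z)%C (c0 + d0) (c1 + d1) (c2 + d2).
Proof.
  intros (F3 & BF & HF) (G3 & BG & HG). exists (fun z => F3 z + G3 z)%C.
  split; [auto with bounded|].
  generalize (filter_and _ _ HF HG). apply near0_imp. intros z [-> ->]. ring.
Qed.

Lemma jet2_mult {F G : C -> C} {c0 c1 c2 d0 d1 d2 : C} :
  jet2 F c0 c1 c2 -> jet2 G d0 d1 d2 ->
  jet2 (fun z => F z * G z)%C
    (c0 * d0) (c0 * d1 + c1 * d0) (c0 * d2 + c1 * d1 + c2 * d0).
Proof.
  intros (F3 & BF & HF) (G3 & BG & HG).
  exists (fun z => (c0 * G3 z + c1 * d2 + c2 * d1 + F3 z * d0)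
                   + z * ((c1 * G3 z + c2 * d2 + F3 z * d1)
                          + z * ((c2 * G3 z + F3 z * d2) + z * (F3 z * G3 z))))%C.
  split; [auto 12 with bounded|].
  generalize (filter_and _ _ HF HG). apply near0_imp. intros z [-> ->]. ring.
Qed.

Lemma jet2_scal (c : C) {F : C -> C} {c0 c1 c2 : C} :
  jet2 F c0 c1 c2 -> jet2 (fun z => c * F z)%C (c * c0) (c * c1) (c * c2).
Proof.
  intros HF. generalize (jet2_mult (jet2_const c) HF).
  apply jet2_eq; ring.
Qed.

Lemma jet2_comp {F w : C -> C} {c0 c1 c2 w1 w2 : C} :
  jet2 F c0 c1 c2 -> jet2 w 0 w1 w2 ->
  jet2 (fun z => F (w z)) c0 (c1 * w1) (c1 * w2 + c2 * (w1 * w1)).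
Proof.
  intros (F3 & BF & HF) Hw. destruct (jet2_continuous Hw) as [_ w_to_0].
  assert (BFw := bounded_near_0_comp BF w_to_0).
  apply w_to_0 in HF. unfold filtermap in HF. destruct Hw as (W & BW & Ew).
  set (v := fun z => (w1 + z * (w2 + z * W z))%C).
  exists (fun z => c1 * W z + c2 * (w1 * (w2 + z * W z) + (w2 + z * W z) * v z)
                   + v z * (v z * (v z * F3 (w z))))%C.
  split; [unfold v; auto 14 with bounded|].
  generalize (filter_and _ _ HF Ew). apply near0_imp. intros z [-> Ez].
  replace (w z) with (z * v z)%C at 1 2 3 by (rewrite Ez; unfold v; ring).
  unfold v; ring.
Qed.

(** * Functions with Taylor expansions of all orders *)

Definition expandable_at (F : C -> C) (z : C) : Prop :=
  forall n, taylor n (fun h => F (z + h)%C).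

Lemma expandable_at_continuous (F : C -> C) (z : C) :
  expandable_at F z -> continuous F z.
Proof.
  intros TF. destruct (TF 1%nat) as (c & G & BG & HF).
  destruct (bounded_remainder_continuous BG HF) as [E0 Hlim].
  rewrite Cplus_0_r in E0. rewrite <- E0 in Hlim.
  intros P HP. apply locally_translate. exact (Hlim P HP).
Qed.

Lemma expandable_at_ext (F G : C -> C) (z : C) :
  locally z (fun x => F x = G x) -> expandable_at F z -> expandable_at G z.
Proof.
  intros HFG TF n. generalize (TF n). apply taylor_ext.
  exact (proj2 (locally_translate z _) HFG).
Qed.

Lemma expandable_at_const (c z : C) : expandable_at (fun _ => c) z.
Proof. intros n. apply taylor_const. Qed.

Lemma expandable_at_id (z : C) : expandable_at (fun x => x) z.
Proof. intros n. apply taylor_plus; [apply taylor_const | apply taylor_id]. Qed.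

Lemma expandable_at_plus (F G : C -> C) (z : C) :
  expandable_at F z -> expandable_at G z -> expandable_at (fun x => F x + G x)%C z.
Proof. intros TF TG n. now apply taylor_plus. Qed.

Lemma expandable_at_mult (F G : C -> C) (z : C) :
  expandable_at F z -> expandable_at G z -> expandable_at (fun x => F x * G x)%C z.
Proof. intros TF TG n. now apply taylor_mult. Qed.

Lemma expandable_at_opp (F : C -> C) (z : C) :
  expandable_at F z -> expandable_at (fun x => - F x)%C z.
Proof.
  intros TF. apply (expandable_at_ext (fun x => (-1) * F x)%C).
  - apply filter_forall. intros x. change ((-1) * F x = - F x)%C. ring.
  - apply expandable_at_mult; [apply expandable_at_const | assumption].
Qed.

Lemma expandable_at_inv (F : C -> C) (z : C) :
  F z <> 0 -> expandable_at F z -> expandable_at (fun x => / F x)%C z.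
Proof.
  intros HF TF n. apply (taylor_inv (fun h => F (z + h)%C) TF). now rewrite Cplus_0_r.
Qed.

#[local] Hint Resolve expandable_at_const expandable_at_id expandable_at_plus
  expandable_at_mult expandable_at_opp expandable_at_inv : expandable.

Lemma expandable_at_0_jet2 (F : C -> C) :
  expandable_at F 0 -> exists c1 c2 : C, jet2 F (F 0) c1 c2.
Proof.
  intros TF. destruct (taylor_jet2 _ (TF 3%nat)) as (c0 & c1 & c2 & HF).
  assert (HF' : jet2 F c0 c1 c2).
  { revert HF. apply jet2_ext, near0_forall. intros z. now rewrite Cplus_0_l. }
  exists c1, c2. now rewrite (proj1 (jet2_continuous HF')).
Qed.

Lemma taylor_div_id (n : nat) (F Q : C -> C) (c1 c2 : C) :
  jet2 F 0 c1 c2 -> near0 (fun z => F z = z * Q z)%C -> Q 0 = c1 ->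
  taylor (S (S n)) F -> taylor (S n) Q.
Proof.
  intros (G & BG & HG) HQ Q0 (d0 & F1 & (d1 & F2 & TF2 & H1) & H0).
  assert (E0 : d0 = 0).
  { transitivity (F 0); [rewrite (locally_singleton _ _ H0)
                          | rewrite (locally_singleton _ _ HQ)]; ring. }
  subst d0.
  assert (Heq : near0 (fun z => z * (c1 + z * (c2 + z * G z)) = z * (d1 + z * F2 z))%C).
  { generalize (filter_and _ _ HG (filter_and _ _ H0 H1)).
    apply near0_imp. intros z (EG & EF & <-).
    transitivity (F z); [rewrite EG | rewrite EF]; ring. }
  apply bounded_remainder_unique in Heq;
    [|auto with bounded | now apply (taylor_bounded n)].
  destruct Heq as [Ecd _].
  apply (taylor_ext _ F1); [|now exists d1, F2].
  generalize (filter_and _ _ HQ (filter_and _ _ H0 H1)).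
  apply near0_imp. intros z (EQ & EF & EF1).
  destruct (Ceq_dec z 0) as [->|Hz].
  - rewrite EF1, Q0, Ecd. ring.
  - replace (Q z) with (/ z * (z * Q z))%C by now field.
    rewrite <- EQ, EF. now field.
Qed.

Lemma expandable_div_id (F : C -> C) :
  expandable_at F 0 -> F 0 = 0 ->
  exists Q : C -> C, (forall z, F z = z * Q z)%C /\
    forall z, expandable_at F z -> expandable_at Q z.
Proof.
  intros TF F0. destruct (expandable_at_0_jet2 F TF) as (c1 & c2 & HF).
  rewrite F0 in HF.
  set (Q := fun z => if Ceq_dec z 0 then c1 else (/ z * F z)%C).
  assert (HQ0 : Q 0 = c1) by (unfold Q; destruct (Ceq_dec 0 0); congruence).
  assert (HQ : forall z : C, z <> 0 -> Q z = (/ z * F z)%C)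
    by (intros z Hz; unfold Q; destruct (Ceq_dec z 0); congruence).
  assert (EQ : forall z, F z = (z * Q z)%C).
  { intros z. destruct (Ceq_dec z 0) as [->|Hz]; [rewrite F0; ring|].
    rewrite HQ by assumption. now field. }
  exists Q. split; [assumption|].
  intros z TFz. destruct (Ceq_dec z 0) as [->|Hz].
  - intros n.
    apply (taylor_ext _ Q); [apply near0_forall; intros; now rewrite Cplus_0_l|].
    apply taylor_pred, (taylor_div_id n F Q c1 c2 HF (near0_forall _ EQ) HQ0).
    apply (taylor_ext _ (fun h => F (0 + h)%C)); [|apply TF].
    apply near0_forall. intros. now rewrite Cplus_0_l.
  - apply (expandable_at_ext (fun x => / x * F x)%C); [|auto with expandable].
    apply locally_Cmod. exists (Cmod z). split; [now apply Cmod_gt_0|].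
    intros x Hx. symmetry. apply HQ. intros ->.
    replace (0 - z)%C with (- z)%C in Hx by ring. rewrite Cmod_opp in Hx. lra.
Qed.

(** * Maximum modulus principle *)

Lemma list_argmax {T : Type} (f : T -> R) (l : list T) :
  l <> nil -> exists t, In t l /\ forall s, In s l -> f s <= f t.
Proof.
  intros Hl. induction l as [|x l IH]; [contradiction|].
  destruct (classic (l = nil)) as [->|Hne].
  - exists x. split; [now left|]. intros s [->|[]]. lra.
  - destruct (IH Hne) as (t & Ht & Hmax).
    destruct (Rle_or_lt (f t) (f x)) as [Hle|Hlt].
    + exists x. split; [now left|]. intros s [->|Hs]; [lra|].
      specialize (Hmax s Hs). lra.
    + exists t. split; [now right|]. intros s [->|Hs]; [lra | auto].
Qed.

Lemma closed_bounded_attains_max (K : C -> Prop) (u : C -> R) (rho : R) (z1 : C) :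
  closed K -> (forall z, K z -> Cmod z <= rho) -> K z1 ->
  (forall z, K z -> continuous u z) ->
  exists z0, K z0 /\ forall z, K z -> u z <= u z0.
Proof.
  intros Kclosed Kbounded Kz1 ucont. apply NNPP. intros Hno.
  assert (Hcover : forall p : C, exists dq : posreal * C, K (snd dq) /\
    forall z, ball p (fst dq) z -> K z -> u z < u (snd dq)).
  { intros p. destruct (classic (K p)) as [Kp|nKp].
    - assert (Hq : exists q, K q /\ u p < u q).
      { apply NNPP. intros H. apply Hno. exists p. split; [assumption|].
        intros z Kz. apply Rnot_lt_le. intros Hlt. apply H. now exists z. }
      destruct Hq as (q & Kq & Hpq).
      destruct (ucont p Kp _ (open_lt (u q) (u p) Hpq)) as [d Hd].
      exists (d, q). split; [assumption|]. intros z Hz _. exact (Hd z Hz).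
    - assert (Hout : locally p (fun z => ~ K z))
        by (apply NNPP; intros H; apply nKp, Kclosed, H).
      destruct Hout as [d Hd]. exists (d, z1). split; [assumption|].
      intros z Hz Kz. now destruct (Hd z Hz). }
  destruct (functional_choice _ Hcover) as [dq Hdq].
  apply (compactness_list 2 (- rho, (- rho, tt)) (rho, (rho, tt))
           (fun x => fst (dq (fst x, fst (snd x))))).
  intros [l Hl].
  set (top := fun x : Compactness.Tn 2 R => snd (dq (fst x, fst (snd x)))).
  assert (Hdom : forall z, K z -> exists x, In x l /\ u z < u (top x)).
  { intros z Kz. assert (Hz := Kbounded z Kz). assert (Hm := Rmax_Cmod z).
    assert (Hfst := Rmax_l (Rabs (fst z)) (Rabs (snd z))).
    assert (Hsnd := Rmax_r (Rabs (fst z)) (Rabs (snd z))).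
    destruct (Hl (fst z, (snd z, tt))) as ([x1 [x2 []]] & Hin & _ & Hclose).
    { split; [|split; [|exact I]]; apply Rabs_le_between; lra. }
    exists (x1, (x2, tt)). split; [assumption|].
    apply (Hdq (x1, x2)); [|assumption].
    split; [apply (proj1 Hclose) | apply (proj1 (proj2 Hclose))]. }
  destruct (list_argmax (fun x => u (top x)) l) as (x & _ & Hmax).
  { intros ->. destruct (Hdom z1 Kz1) as (x & [] & _). }
  destruct (Hdom (top x)) as (y & Hy & Hlt); [apply Hdq|].
  specialize (Hmax y Hy). lra.
Qed.

Lemma Cmod_parallelogram (z h : C) :
  Cmod (z + h) ^ 2 + Cmod (z - h) ^ 2 = 2 * Cmod z ^ 2 + 2 * Cmod h ^ 2.
Proof. rewrite !Cmod2_alt. destruct z, h; simpl. ring. Qed.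

Lemma Re_conj_mult_le (a x : C) : Re (Cconj a * x) <= Cmod a * Cmod x.
Proof.
  rewrite <- (Cmod_conj a), <- Cmod_mult.
  eapply Rle_trans; [apply Rle_abs | apply re_le_Cmod].
Qed.

Lemma sum4_Cmod_sq_ge (a x1 x2 x3 x4 : C) :
  4 * Cmod a ^ 2 - 2 * Cmod a * Cmod (x1 + x2 + x3 + x4 - 4 * a)
    <= Cmod x1 ^ 2 + Cmod x2 ^ 2 + Cmod x3 ^ 2 + Cmod x4 ^ 2.
Proof.
  assert (Hcs := Re_conj_mult_le (- a) (x1 + x2 + x3 + x4 - 4 * a)).
  rewrite Cmod_opp in Hcs.
  assert (Hsq : forall x, 2 * Re (Cconj a * x) - Cmod a ^ 2 <= Cmod x ^ 2).
  { intros x. assert (Hx := pow2_ge_0 (Cmod (x - a))). rewrite Cmod2_alt in *.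
    rewrite Cmod2_alt. destruct a, x; simpl in *. lra. }
  generalize (Hsq x1) (Hsq x2) (Hsq x3) (Hsq x4). rewrite (Cmod2_alt a) in *.
  destruct a, x1, x2, x3, x4; simpl in *. lra.
Qed.

Lemma four_point_sum_error {F : C -> C} {c0 c1 c2 : C} :
  jet2 F c0 c1 c2 ->
  exists K d : R, 0 < d /\ forall t : R, 0 < t < d ->
    Cmod (F t + F (- t) + F (Ci * t) + F (- (Ci * t)) - 4 * c0)%C <= 4 * K * t ^ 3.
Proof.
  intros (G & [K HG] & HF). exists K.
  assert (Hloc := filter_and _ _ HG HF).
  apply near0_Cmod in Hloc. destruct Hloc as (d & Hd & Hloc).
  exists d. split; [assumption|]. intros t Ht.
  assert (Hm : Cmod t = t) by (apply Cmod_R_pos_eq; lra).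
  assert (Hmi : Cmod (Ci * t) = t) by (rewrite Cmod_mult, Cmod_Ci, Hm; ring).
  destruct (Hloc t) as (G1 & F1); [lra|].
  destruct (Hloc (- t)%C) as (G2 & F2); [rewrite Cmod_opp; lra|].
  destruct (Hloc (Ci * t)%C) as (G3 & F3); [lra|].
  destruct (Hloc (- (Ci * t))%C) as (G4 & F4); [rewrite Cmod_opp; lra|].
  rewrite F1, F2, F3, F4.
  revert G1 G2 G3 G4. generalize (G t) (G (- t)%C) (G (Ci * t)%C) (G (- (Ci * t))%C).
  intros g1 g2 g3 g4 G1 G2 G3 G4.
  match goal with |- Cmod ?x <= _ =>
    replace x with (t * t * t * ((g1 + - g2) + Ci * (g4 + - g3)))%C
      by (destruct c0, c1, c2, g1, g2, g3, g4;
          apply injective_projections; simpl; ring)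
  end.
  rewrite !Cmod_mult, Hm. replace (4 * K * t ^ 3) with (t * t * t * (4 * K)) by ring.
  apply Rmult_le_compat_l; [repeat apply Rmult_le_pos; lra|].
  assert (Htri := Cmod_triangle (g1 + - g2) (Ci * (g4 + - g3))).
  assert (Htri12 := Cmod_triangle g1 (- g2)). assert (Htri43 := Cmod_triangle g4 (- g3)).
  rewrite Cmod_opp in Htri12, Htri43. rewrite Cmod_mult, Cmod_Ci in Htri. lra.
Qed.

(* Averaging over [z0 + i^j t] kills the terms of degree 1 and 2 of [F], so the
   average of [|F|^2] is at least [|F z0|^2 - O(t^3)], while that of [e |z|^2]
   exceeds its value at [z0] by [e t^2]. *)
Lemma perturbed_modulus_no_local_max (F : C -> C) (z0 : C) (e : R) :
  0 < e -> taylor 3 (fun h => F (z0 + h)%C) ->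
  ~ locally z0 (fun z =>
      Cmod (F z) ^ 2 + e * Cmod z ^ 2 <= Cmod (F z0) ^ 2 + e * Cmod z0 ^ 2).
Proof.
  intros He TF Hmax.
  destruct (taylor_jet2 _ TF) as (c0 & c1 & c2 & HF).
  destruct (jet2_continuous HF) as [E0 _]. rewrite Cplus_0_r in E0.
  destruct (four_point_sum_error HF) as (K & d & Hd & Hsum).
  apply locally_translate, near0_Cmod in Hmax. destruct Hmax as (r & Hr & Hmax).
  assert (e <= 0); [|lra].
  apply (Rle_of_small_error _ _ (2 * Cmod c0 * K) (Rmin d r)); [now apply Rmin_pos|].
  intros t [Ht Htdr].
  assert (Htd := Rlt_le_trans _ _ _ Htdr (Rmin_l d r)).
  assert (Htr := Rlt_le_trans _ _ _ Htdr (Rmin_r d r)).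
  assert (Hm : Cmod t = t) by (apply Cmod_R_pos_eq; lra).
  assert (Hmi : Cmod (Ci * t) = t) by (rewrite Cmod_mult, Cmod_Ci, Hm; ring).
  assert (max_t := Hmax t ltac:(lra)).
  assert (max_opp_t := Hmax (- t)%C ltac:(rewrite Cmod_opp; lra)).
  assert (max_it := Hmax (Ci * t)%C ltac:(lra)).
  assert (max_opp_it := Hmax (- (Ci * t))%C ltac:(rewrite Cmod_opp; lra)).
  assert (par_t := f_equal (Rmult e) (Cmod_parallelogram z0 t)).
  assert (par_it := f_equal (Rmult e) (Cmod_parallelogram z0 (Ci * t))).
  rewrite Hm in par_t. rewrite Hmi in par_it. unfold Cminus in par_t, par_it.
  assert (Hsq := sum4_Cmod_sq_ge c0 (F (z0 + t)%C) (F (z0 + - t)%C)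
                   (F (z0 + Ci * t)%C) (F (z0 + - (Ci * t))%C)).
  assert (Herr := Rmult_le_compat_l (2 * Cmod c0) _ _
    ltac:(generalize (Cmod_ge_0 c0); lra) (Hsum t (conj Ht Htd))).
  cbv beta in Herr. rewrite E0 in max_t, max_opp_t, max_it, max_opp_it.
  assert (0 < t ^ 2) by now apply pow_lt.
  apply (Rmult_le_reg_r (4 * t ^ 2)); lra.
Qed.

Lemma continuous_Cmod (z : C) : continuous Cmod z.
Proof. exact (@filterlim_norm _ C_NormedModule z). Qed.

Lemma continuous_Cmod_sq (F : C -> C) (z : C) :
  continuous F z -> continuous (fun x => Cmod (F x) ^ 2) z.
Proof.
  intros HF. apply (continuous_comp (fun x => Cmod (F x)) (fun m => m ^ 2)).
  - now apply (continuous_comp F Cmod), continuous_Cmod.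
  - apply (ex_derive_continuous (V := R_NormedModule)). auto_derive. trivial.
Qed.

Lemma closed_Cmod_le (rho : R) : closed (fun z : C => Cmod z <= rho).
Proof.
  apply (closed_comp Cmod (fun m => m <= rho)), closed_le. exact continuous_Cmod.
Qed.

Lemma open_Cmod_lt (rho : R) : open (fun z : C => Cmod z < rho).
Proof.
  apply (open_comp Cmod (fun m => m < rho)), open_lt. intros z _. apply continuous_Cmod.
Qed.

Lemma maximum_modulus (F : C -> C) (rho M : R) :
  0 <= rho -> (forall z, Cmod z <= rho -> expandable_at F z) ->
  (forall z, Cmod z = rho -> Cmod (F z) <= M) ->
  forall z, Cmod z <= rho -> Cmod (F z) <= M.
Proof.
  intros Hrho HF Hbd z Hz.
  assert (HM : 0 <= M).
  { eapply Rle_trans; [apply Cmod_ge_0|].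
    apply (Hbd rho). now apply Cmod_R_pos_eq. }
  apply Rsqr_incr_0_var; [rewrite !Rsqr_pow2 | assumption].
  apply (Rle_of_small_error _ _ (rho ^ 2) 1); [lra|]. intros e He.
  set (u := fun z => Cmod (F z) ^ 2 + e * Cmod z ^ 2).
  destruct (closed_bounded_attains_max (fun z => Cmod z <= rho) u rho z)
    as (z0 & Hz0 & Hmax).
  - apply closed_Cmod_le.
  - trivial.
  - assumption.
  - intros x Hx. apply (continuous_plus (V := R_NormedModule)).
    + now apply continuous_Cmod_sq, expandable_at_continuous, HF.
    + apply (continuous_scal_r (V := R_NormedModule)).
      apply (continuous_Cmod_sq (fun z => z)), continuous_id.
  - assert (Hbdry : Cmod z0 = rho).
    { apply Rle_antisym; [assumption|]. apply Rnot_lt_le. intros Hin.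
      apply (perturbed_modulus_no_local_max F z0 e); [lra | now apply (HF z0)|].
      generalize (open_Cmod_lt rho z0 Hin). apply filter_imp.
      intros x Hx. apply Hmax. lra. }
    specialize (Hmax z Hz). unfold u in Hmax. rewrite Hbdry in Hmax.
    assert (HM2 := pow_incr (Cmod (F z0)) M 2 (conj (Cmod_ge_0 _) (Hbd z0 Hbdry))).
    assert (0 <= e * Cmod z ^ 2) by (apply Rmult_le_pos; [lra | apply pow2_ge_0]).
    lra.
Qed.

(** * Schwarz and Schwarz-Pick inequalities *)

Lemma schwarz_quotient (F : C -> C) :
  (forall z, Cmod z < 1 -> expandable_at F z) -> F 0 = 0 ->
  (forall z, Cmod z < 1 -> Cmod (F z) <= 1) ->
  exists Q : C -> C, (forall z, F z = z * Q z)%C /\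
    (forall z, Cmod z < 1 -> expandable_at Q z) /\
    (forall z, Cmod z < 1 -> Cmod (Q z) <= 1).
Proof.
  intros TF F0 HF.
  destruct (expandable_div_id F) as (Q & EQ & TQ); [|assumption|].
  { apply TF. rewrite Cmod_0. lra. }
  exists Q. split; [assumption|]. split; [auto|]. intros z Hz.
  apply (Rle_of_small_error _ _ (Cmod (Q z)) (1 - Cmod z)); [lra|]. intros s Hs.
  assert (Hz0 := Cmod_ge_0 z).
  assert (HQ : Cmod (Q z) <= / (1 - s)).
  { apply (maximum_modulus Q (1 - s)); [lra| | |lra].
    - intros x Hx. apply TQ, TF. lra.
    - intros x Hx. specialize (HF x ltac:(lra)). rewrite EQ, Cmod_mult, Hx in HF.
      apply (Rmult_le_reg_l (1 - s)); [lra|]. rewrite Rinv_r by lra. assumption. }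
  apply (Rmult_le_compat_l (1 - s)) in HQ; [|lra]. rewrite Rinv_r in HQ by lra. lra.
Qed.

Lemma Cmod_mobius_le (a x : C) :
  Cmod a <= 1 -> Cmod x <= 1 -> Cmod (x - a) <= Cmod (1 - Cconj a * x).
Proof.
  intros Ha Hx. apply Rsqr_incr_0_var; [rewrite !Rsqr_pow2 | apply Cmod_ge_0].
  assert (Ha2 := pow_incr (Cmod a) 1 2 (conj (Cmod_ge_0 a) Ha)).
  assert (Hx2 := pow_incr (Cmod x) 1 2 (conj (Cmod_ge_0 x) Hx)).
  assert (Hprod : 0 <= (1 - Cmod a ^ 2) * (1 - Cmod x ^ 2))
    by (apply Rmult_le_pos; lra).
  rewrite !Cmod2_alt in *. destruct a, x; simpl in *. lra.
Qed.

Lemma schwarz_pick_0_strict (F : C -> C) (c0 c1 c2 : C) :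
  (forall z, Cmod z < 1 -> expandable_at F z) ->
  (forall z, Cmod z < 1 -> Cmod (F z) < 1) ->
  jet2 F c0 c1 c2 -> Cmod c1 <= 1 - Cmod c0 ^ 2.
Proof.
  intros TF HF HJ.
  assert (F0 : F 0 = c0) by now destruct (jet2_continuous HJ).
  assert (Hc0 : Cmod c0 < 1) by (rewrite <- F0; apply HF; rewrite Cmod_0; lra).
  set (den := fun z => (1 + - (Cconj c0 * F z))%C).
  assert (Hden : forall z, Cmod z < 1 -> den z <> 0).
  { intros z Hz E. assert (E1 : (Cconj c0 * F z)%C = 1).
    { replace (Cconj c0 * F z)%C with (1 - den z)%C by (unfold den; ring).
      rewrite E. ring. }
    apply (f_equal Cmod) in E1. rewrite Cmod_mult, Cmod_conj, Cmod_1 in E1.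
    specialize (HF z Hz). assert (Fz_ge_0 := Cmod_ge_0 (F z)). nra. }
  destruct (schwarz_quotient (fun z => (F z + - c0) * / den z)%C) as (Q & EQ & TQ & HQ).
  - unfold den in *. intros z Hz. specialize (Hden z Hz). auto 8 with expandable.
  - rewrite F0. ring.
  - intros z Hz. rewrite Cmod_mult, Cmod_inv by auto.
    apply (Rmult_le_reg_r (Cmod (den z))); [now apply Cmod_gt_0, Hden|].
    rewrite Rmult_assoc, Rinv_l, Rmult_1_r, Rmult_1_l
      by (apply Rgt_not_eq, Cmod_gt_0; auto).
    apply Cmod_mobius_le; left; auto.
  - assert (Zero : Cmod 0 < 1) by (rewrite Cmod_0; lra).
    destruct (expandable_at_0_jet2 Q (TQ 0%C Zero)) as (q1 & q2 & HQJ).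
    assert (denJ := jet2_plus (jet2_const 1) (jet2_scal (- Cconj c0) HJ)).
    assert (HFJ := jet2_plus (jet2_const c0)
                     (jet2_mult (jet2_mult jet2_id HQJ) denJ)).
    apply (jet2_ext _ F) in HFJ.
    2: { apply near0_Cmod. exists 1. split; [lra|]. intros z Hz. rewrite <- EQ.
         specialize (Hden z Hz). unfold den in *. field. assumption. }
    destruct (jet2_unique HJ HFJ) as (_ & E1 & _).
    replace c1 with (Q 0 * RtoC (1 - Cmod c0 ^ 2))%C.
    2: { rewrite E1, RtoC_minus, Cmod2_conj. ring. }
    assert (Hc2 : 0 <= 1 - Cmod c0 ^ 2) by (assert (c0_ge_0 := Cmod_ge_0 c0); nra).
    rewrite Cmod_mult, Cmod_R, Rabs_pos_eq by assumption.
    rewrite <- (Rmult_1_l (1 - Cmod c0 ^ 2)) at 2.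
    apply Rmult_le_compat_r; auto.
Qed.

(* Scaling [F] by [t < 1] keeps the denominator of the Moebius transform away from 0. *)
Lemma schwarz_pick_0 (F : C -> C) (c0 c1 c2 : C) :
  (forall z, Cmod z < 1 -> expandable_at F z) ->
  (forall z, Cmod z < 1 -> Cmod (F z) <= 1) ->
  jet2 F c0 c1 c2 -> Cmod c1 <= 1 - Cmod c0 ^ 2.
Proof.
  intros TF HF HJ.
  apply (Rle_of_small_error _ _ (Cmod c1 + 2 * Cmod c0 ^ 2) 1); [lra|]. intros s Hs.
  set (t := 1 - s).
  assert (Hmt : Cmod t = t) by (apply Cmod_R_pos_eq; unfold t; lra).
  assert (Hscaled : Cmod (t * c1) <= 1 - Cmod (t * c0) ^ 2).
  { apply (schwarz_pick_0_strict (fun z => t * F z)%C _ _ (t * c2)%C).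
    - auto with expandable.
    - intros z Hz. specialize (HF z Hz). rewrite Cmod_mult, Hmt.
      unfold t. nra.
    - now apply jet2_scal. }
  rewrite !Cmod_mult, Hmt in Hscaled. unfold t in Hscaled. nra.
Qed.

Lemma schwarz_second_coef_le (w : C -> C) (w1 w2 : C) :
  (forall z, Cmod z < 1 -> expandable_at w z) ->
  (forall z, Cmod z < 1 -> Cmod (w z) <= 1) ->
  jet2 w 0 w1 w2 -> Cmod w2 <= 1 - Cmod w1 ^ 2.
Proof.
  intros Tw Hw HJ.
  destruct (schwarz_quotient w) as (Q & EQ & TQ & HQ); [assumption| |assumption|].
  { now destruct (jet2_continuous HJ). }
  destruct (expandable_at_0_jet2 Q) as (q1 & q2 & HQJ).
  { apply TQ. rewrite Cmod_0. lra. }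
  assert (HwJ := jet2_mult jet2_id HQJ).
  apply (jet2_ext _ w) in HwJ; [|apply near0_forall; auto].
  destruct (jet2_unique HJ HwJ) as (_ & E1 & E2).
  replace w1 with (Q 0) by (rewrite E1; ring).
  replace w2 with q1 by (rewrite E2; ring).
  exact (schwarz_pick_0 Q _ _ _ TQ HQ HQJ).
Qed.

(** * Complex power series *)

Local Notation C_series := (@is_series C_AbsRing C_NormedModule).

Lemma norm_is_series_le {K : AbsRing} {V : NormedModule K}
    (a : nat -> V) (b : nat -> R) (l : V) (M : R) :
  is_series a l -> is_series b M -> (forall n, norm (a n) <= b n) -> norm l <= M.
Proof.
  intros Ha Hb Hab.
  apply (is_lim_seq_le (fun n => norm (sum_n a n)) (sum_n b) (norm l) M).
  - intros n. eapply Rle_trans; [apply norm_sum_n_m | now apply sum_n_m_le].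
  - exact (filterlim_comp _ _ _ _ _ _ _ _ Ha (filterlim_norm l)).
  - exact Hb.
Qed.

Lemma is_series_half_geom (M : R) : is_series (fun n => M * (1 / 2) ^ n) (2 * M).
Proof.
  replace (2 * M) with (M * / (1 - 1 / 2)) by field.
  apply (is_series_scal M (fun n => (1 / 2) ^ n)), is_series_geom.
  rewrite Rabs_pos_eq; lra.
Qed.

Lemma C_series_half_geom_le (a : nat -> C) (l : C) (M : R) :
  C_series a l -> (forall n, Cmod (a n) <= M * (1 / 2) ^ n) -> Cmod l <= 2 * M.
Proof.
  intros Ha HM. exact (norm_is_series_le a _ l _ Ha (is_series_half_geom M) HM).
Qed.

Lemma pow_n_Cpow (z : C) (n : nat) : @pow_n C_Ring z n = (z ^ n)%C.
Proof. induction n as [|n IH]; [reflexivity | exact (f_equal (Cmult z) IH)]. Qed.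

Lemma C_psum_series (c : nat -> C) (z l : C) :
  C_psum c z l <-> C_series (fun n => z ^ n * c n)%C l.
Proof.
  split; apply is_series_ext; intros n;
    [|symmetry]; exact (f_equal (fun x : C => x * c n)%C (pow_n_Cpow z n)).
Qed.

Lemma C_psum_coef_bound (c : nat -> C) (s : R) (l : C) :
  0 <= s -> C_psum c s l ->
  exists M : R, forall n, Cmod (c n) * s ^ n <= M.
Proof.
  intros Hs H. apply C_psum_series in H.
  destruct (@filterlim_bounded C_AbsRing C_NormedModule
    (@sum_n C_AbelianMonoid (fun n => s ^ n * c n)%C) (ex_intro _ l H)) as [M HM].
  change (forall n, Cmod (@sum_n C_AbelianMonoid (fun n => s ^ n * c n)%C n) <= M) in HM.
  assert (M0 := Rle_trans _ _ _ (Cmod_ge_0 _) (HM 0%nat)).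
  exists (2 * M). intros n.
  replace (Cmod (c n) * s ^ n) with (Cmod (s ^ n * c n)).
  2: { rewrite Cmod_mult, Cmod_pow, Cmod_R, Rabs_pos_eq by assumption. ring. }
  destruct n as [|n].
  - specialize (HM 0%nat). rewrite sum_O in HM. lra.
  - assert (Hn := HM n). assert (HSn := HM (S n)). rewrite sum_Sn in HSn.
    revert Hn HSn. generalize (@sum_n C_AbelianMonoid (fun n => s ^ n * c n)%C n : C).
    intros p Hn HSn. change (Cmod (p + s ^ S n * c (S n)) <= M) in HSn.
    assert (Htri := Cmod_triangle (p + s ^ S n * c (S n)) (- p)).
    replace (p + s ^ S n * c (S n) + - p)%C with (s ^ S n * c (S n))%C in Htri by ring.
    rewrite Cmod_opp in Htri. lra.
Qed.

Lemma near0_C_psum_geom (c : nat -> C) (F : C -> C) :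
  near0 (fun z => C_psum c z (F z)) ->
  exists s M : R, 0 < s /\
    (forall z, Cmod z <= s -> C_psum c z (F z)) /\
    forall n, s ^ n * Cmod (c n) <= M * (1 / 2) ^ n.
Proof.
  intros H. apply near0_Cmod in H. destruct H as (r & Hr & H).
  assert (Hs : Cmod (RtoC (r / 2)) = r / 2) by (apply Cmod_R_pos_eq; lra).
  destruct (C_psum_coef_bound c (r / 2) (F (r / 2))) as [M Hc].
  { lra. }
  { apply H. lra. }
  exists (r / 4), M. split; [lra|]. split; [intros z Hz; apply H; lra|]. intros n.
  replace (r / 4) with (r / 2 * (1 / 2)) by field. rewrite Rpow_mult_distr.
  replace ((r / 2) ^ n * (1 / 2) ^ n * Cmod (c n))
    with (Cmod (c n) * (r / 2) ^ n * (1 / 2) ^ n) by ring.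
  apply Rmult_le_compat_r; [apply pow_le; lra | apply Hc].
Qed.

Lemma C_psum_bounded (c : nat -> C) (F : C -> C) :
  near0 (fun z => C_psum c z (F z)) -> bounded_near_0 F.
Proof.
  intros H. destruct (near0_C_psum_geom c F H) as (s & M & Hs & HF & Hc).
  exists (2 * M). apply near0_Cmod. exists s. split; [assumption|]. intros z Hz.
  apply (C_series_half_geom_le (fun n => z ^ n * c n)%C).
  - apply C_psum_series, HF. lra.
  - intros n. eapply Rle_trans; [|apply Hc]. rewrite Cmod_mult, Cmod_pow.
    apply Rmult_le_compat_r; [apply Cmod_ge_0|].
    apply pow_incr. split; [apply Cmod_ge_0 | lra].
Qed.

Lemma C_psum_shift (c : nat -> C) (F : C -> C) :
  near0 (fun z => C_psum c z (F z)) ->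
  exists G : C -> C, near0 (fun z => C_psum (fun n => c (S n)) z (G z)) /\
    near0 (fun z => F z = c 0%nat + z * G z)%C.
Proof.
  intros H.
  exists (fun z => if Ceq_dec z 0 then c 1%nat else (/ z * (F z - c 0%nat))%C).
  split; revert H; apply near0_imp; intros z H; destruct (Ceq_dec z 0) as [->|Hz].
  - exact (is_pseries_0 (fun n => c (S n))).
  - exact (is_pseries_decr_1 c z (/ z)%C (F z) (Cinv_l z Hz) H).
  - rewrite (filterlim_locally_unique _ _ _ H (is_pseries_0 c)).
    change (c 0%nat = c 0%nat + 0 * c 1%nat)%C. ring.
  - now field.
Qed.

Lemma C_psum_taylor (n : nat) (c : nat -> C) (F : C -> C) :
  near0 (fun z => C_psum c z (F z)) -> taylor n F.
Proof.
  revert c F. induction n as [|n IH]; intros c F H; [now apply (C_psum_bounded c)|].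
  destruct (C_psum_shift c F H) as (G & HG & HF).
  exists (c 0%nat), G. split; [exact (IH _ G HG) | assumption].
Qed.

Lemma C_psum_jet2 (c : nat -> C) (F : C -> C) :
  near0 (fun z => C_psum c z (F z)) -> jet2 F (c 0%nat) (c 1%nat) (c 2%nat).
Proof.
  intros H. destruct (C_psum_shift _ _ H) as (F1 & H1 & E1).
  destruct (C_psum_shift _ _ H1) as (F2 & H2 & E2).
  destruct (C_psum_shift _ _ H2) as (F3 & H3 & E3).
  exists F3. split; [exact (C_psum_bounded _ _ H3)|].
  generalize (filter_and _ _ E1 (filter_and _ _ E2 E3)).
  apply near0_imp. intros z (-> & -> & ->). reflexivity.
Qed.

Lemma C_psum_coef_unique (n : nat) (c d : nat -> C) (F G : C -> C) :
  near0 (fun z => C_psum c z (F z)) -> near0 (fun z => C_psum d z (G z)) ->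
  near0 (fun z => z * F z = z * G z)%C -> c n = d n.
Proof.
  revert c d F G. induction n as [|n IH]; intros c d F G HF HG HFG;
    destruct (C_psum_shift _ _ HF) as (F1 & HF1 & EF);
    destruct (C_psum_shift _ _ HG) as (G1 & HG1 & EG);
    (assert (Heq : near0 (fun z => z * (c 0%nat + z * F1 z)
                                   = z * (d 0%nat + z * G1 z))%C)
      by (generalize (filter_and _ _ HFG (filter_and _ _ EF EG));
          apply near0_imp; now intros z (E & <- & <-)));
    apply bounded_remainder_unique in Heq; eauto using C_psum_bounded.
  - apply Heq.
  - exact (IH _ _ F1 G1 HF1 HG1 (proj2 Heq)).
Qed.

Lemma analytic_in_expandable_at (D : C -> Prop) (F : C -> C) (z : C) :
  analytic_in D F -> D z -> expandable_at F z.
Proof.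
  intros HF Dz n. destruct (HF z Dz) as (c & r & H).
  apply (C_psum_taylor n c), near0_Cmod. exists r. split; [apply cond_pos|].
  intros h Hh. specialize (H (z + h)%C).
  replace (z + h - z)%C with h in H by ring. auto.
Qed.

Lemma bounded_quotient (n : nat) (E : C -> C) (K : R) :
  near0 (fun z => Cmod (E z) <= K * Cmod z ^ S n) ->
  exists G : C -> C, bounded_near_0 G /\ near0 (fun z => E z = z ^ S n * G z)%C.
Proof.
  intros HE. exists (fun z => if Ceq_dec z 0 then RtoC 0 else (E z / z ^ S n)%C). split.
  - exists (Rmax K 0). revert HE. apply near0_imp. intros z HE.
    destruct (Ceq_dec z 0) as [_|Hz]; [rewrite Cmod_0; apply Rmax_r|].
    eapply Rle_trans; [|apply Rmax_l]. apply Cmod_gt_0 in Hz as Hz'.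
    rewrite Cmod_div, Cmod_pow by now apply Cpow_nz.
    apply Rle_div_l; [now apply pow_lt | assumption].
  - revert HE. apply near0_imp. intros z HE.
    destruct (Ceq_dec z 0) as [->|Hz].
    + rewrite Cmod_0, pow_ne_zero, Rmult_0_r in HE by lia.
      rewrite Cmult_0_r. apply Cmod_eq_0. generalize (Cmod_ge_0 (E 0)). lra.
    + field. now apply (Cpow_nz z (S n)).
Qed.

Lemma C_derive_of_quadratic_error (F : C -> C) (z l : C) (K : R) :
  near0 (fun h => Cmod (F (z + h) - F z - h * l)%C <= K * Cmod h ^ 2) ->
  C_derive F z = l.
Proof.
  intros H. apply bounded_quotient in H. destruct H as (G & BG & HG).
  assert (quotient_to_l : filterlim (fun h => l + h * G h)%C near0 (locally l))
    by now apply (bounded_remainder_continuous BG), near0_forall.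
  apply is_C_lim_unique. intros P HP. specialize (quotient_to_l P HP).
  unfold filtermap in *. apply (proj1 (locally_translate z _)).
  generalize (filter_and _ _ quotient_to_l HG). apply near0_imp. intros h [Ph Eh] Hzh.
  replace ((F (z + h) - F z) / (z + h - z))%C with (l + h * G h)%C; [assumption|].
  assert (Hh : h <> 0) by (intros ->; apply Hzh; apply Cplus_0_r).
  replace (z + h - z)%C with h by ring.
  replace (F (z + h) - F z)%C with (F (z + h) - F z - h * l + h * l)%C by ring.
  rewrite Eh. now field.
Qed.

Lemma Cpow_taylor_remainder (z h : C) (rho : R) (n : nat) :
  Cmod z <= rho -> Cmod h <= rho ->
  Cmod ((z + h) ^ n - z ^ n - h * (INR n * z ^ pred n)) * rho ^ 2
    <= (2 ^ n - 1 - INR n) * (rho ^ n * Cmod h ^ 2).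
Proof.
  intros Hz Hh. assert (Hrho := Rle_trans _ _ _ (Cmod_ge_0 z) Hz).
  assert (Hh0 := Cmod_ge_0 h).
  induction n as [|n IH].
  - simpl. replace (1 - 1 - h * (0 * 1))%C with (RtoC 0) by ring.
    rewrite Cmod_0. lra.
  - set (e := ((z + h) ^ n - z ^ n - h * (INR n * z ^ pred n))%C) in *.
    replace ((z + h) ^ S n - z ^ S n - h * (INR (S n) * z ^ pred (S n)))%C
      with ((z + h) * e + INR n * (h * h * z ^ pred n))%C.
    2: { unfold e. rewrite S_INR, RtoC_plus. destruct n as [|n]; simpl; ring. }
    assert (Htri := Cmod_triangle ((z + h) * e) (INR n * (h * h * z ^ pred n))).
    rewrite !Cmod_mult, Cmod_pow, Cmod_R, (Rabs_pos_eq (INR n)) in Htri by apply pos_INR.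
    apply (Rmult_le_compat_r (rho ^ 2)) in Htri; [|now apply pow_le].
    assert (Hfirst : Cmod (z + h) * (Cmod e * rho ^ 2)
                     <= 2 * rho * ((2 ^ n - 1 - INR n) * (rho ^ n * Cmod h ^ 2))).
    { apply Rmult_le_compat; [apply Cmod_ge_0| | |assumption].
      - apply Rmult_le_pos; [apply Cmod_ge_0 | now apply pow_le].
      - eapply Rle_trans; [apply Cmod_triangle | lra]. }
    assert (Hsecond : INR n * (Cmod z ^ pred n * rho ^ 2) <= INR n * rho ^ S n).
    { destruct n as [|n]; [simpl; lra|].
      apply Rmult_le_compat_l; [apply pos_INR|].
      replace (rho ^ S (S n)) with (rho ^ n * rho ^ 2) by (simpl; ring).
      apply Rmult_le_compat_r; [now apply pow_le|].
      apply pow_incr. split; [apply Cmod_ge_0 | assumption]. }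
    apply (Rmult_le_compat_l (Cmod h ^ 2)) in Hsecond; [|now apply pow_le].
    rewrite S_INR, <- !tech_pow_Rmult in *. lra.
Qed.

Lemma INR_le_pow2 (n : nat) : INR n <= 2 ^ n.
Proof.
  assert (Hpow := Rle_pow_lin 1 n ltac:(lra)).
  replace (1 + 1) with 2 in Hpow by ring. lra.
Qed.

Lemma derived_term_le (z x : C) (rho : R) (n : nat) :
  Cmod z <= rho ->
  Cmod (INR n * z ^ pred n * x) * rho <= (2 * rho) ^ n * Cmod x.
Proof.
  intros Hz. assert (Hrho := Rle_trans _ _ _ (Cmod_ge_0 z) Hz).
  rewrite !Cmod_mult, Cmod_pow, Cmod_R, Rabs_pos_eq by apply pos_INR.
  replace (INR n * Cmod z ^ pred n * Cmod x * rho)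
    with (INR n * (Cmod z ^ pred n * rho) * Cmod x) by ring.
  apply Rmult_le_compat_r; [apply Cmod_ge_0|]. rewrite Rpow_mult_distr.
  destruct n as [|n]; [simpl; lra|].
  apply Rmult_le_compat; [apply pos_INR| |apply INR_le_pow2|].
  - apply Rmult_le_pos; [apply pow_le, Cmod_ge_0 | assumption].
  - rewrite <- tech_pow_Rmult, (Rmult_comm rho).
    apply Rmult_le_compat_r; [assumption|].
    apply pow_incr. split; [apply Cmod_ge_0 | assumption].
Qed.

Lemma C_series_derivative (c : nat -> C) (F : C -> C) (rho M : R) (z D : C) :
  0 < rho -> Cmod z < rho ->
  (forall x, Cmod x <= 2 * rho -> C_psum c x (F x)) ->
  (forall n, (2 * rho) ^ n * Cmod (c n) <= M * (1 / 2) ^ n) ->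
  C_series (fun n => INR n * z ^ pred n * c n)%C D -> C_derive F z = D.
Proof.
  intros Hrho Hz HF Hc HD.
  apply (C_derive_of_quadratic_error F z D (2 * (M / rho ^ 2))).
  apply near0_Cmod. exists rho. split; [assumption|]. intros h Hh.
  assert (Hzh : Cmod (z + h) <= 2 * rho)
    by (eapply Rle_trans; [apply Cmod_triangle | lra]).
  assert (Sz := proj1 (C_psum_series _ _ _) (HF z ltac:(lra))).
  assert (Szh := proj1 (C_psum_series _ _ _) (HF (z + h)%C Hzh)).
  assert (Serr : C_series (fun n => (z + h) ^ n * c n - z ^ n * c n
                                    - h * (INR n * z ^ pred n * c n))%C
                   (F (z + h)%C - F z - h * D)%C)
    by exact (is_series_minus _ _ _ _ (is_series_minus _ _ _ _ Szh Sz)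
                (is_series_scal h _ _ HD)).
  rewrite Rmult_assoc. apply (C_series_half_geom_le _ _ _ Serr). intros n.
  replace ((z + h) ^ n * c n - z ^ n * c n - h * (INR n * z ^ pred n * c n))%C
    with (((z + h) ^ n - z ^ n - h * (INR n * z ^ pred n)) * c n)%C by ring.
  assert (Hrem := Cpow_taylor_remainder z h rho n ltac:(lra) ltac:(lra)).
  rewrite Cmod_mult. revert Hrem.
  generalize (Cmod ((z + h) ^ n - z ^ n - h * (INR n * z ^ pred n))). intros e Hrem.
  assert (Hh2 : 0 <= Cmod h ^ 2) by apply pow2_ge_0.
  assert (Hrn : 0 <= rho ^ n * Cmod h ^ 2)
    by (apply Rmult_le_pos; [apply pow_le; lra | assumption]).
  assert (Hn := pos_INR n).
  replace (M / rho ^ 2 * Cmod h ^ 2 * (1 / 2) ^ n)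
    with (Cmod h ^ 2 * (M * (1 / 2) ^ n) / rho ^ 2) by (field; lra).
  apply -> Rle_div_r; [|now apply pow_lt].
  apply Rle_trans with (Cmod h ^ 2 * ((2 * rho) ^ n * Cmod (c n)));
    [|now apply Rmult_le_compat_l].
  replace (Cmod h ^ 2 * ((2 * rho) ^ n * Cmod (c n)))
    with (2 ^ n * (rho ^ n * Cmod h ^ 2) * Cmod (c n))
    by (rewrite Rpow_mult_distr; ring).
  replace (e * Cmod (c n) * rho ^ 2) with (e * rho ^ 2 * Cmod (c n)) by ring.
  apply Rmult_le_compat_r; [apply Cmod_ge_0 | nra].
Qed.

Lemma C_psum_derive (c : nat -> C) (F : C -> C) :
  near0 (fun z => C_psum c z (F z)) ->
  near0 (fun z => C_psum (fun n => INR (S n) * c (S n))%C z (C_derive F z)).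
Proof.
  intros H. destruct (near0_C_psum_geom c F H) as (s & M & Hs & HF & Hc).
  apply near0_Cmod. exists (s / 2). split; [lra|]. intros z Hz.
  replace s with (2 * (s / 2)) in HF, Hc by field.
  set (rho := s / 2) in *. assert (Hrho : 0 < rho) by (unfold rho; lra).
  set (t := fun n => (INR n * z ^ pred n * c n)%C).
  assert (Ht : forall n, Cmod (t n) <= M / rho * (1 / 2) ^ n).
  { intros n. replace (M / rho * (1 / 2) ^ n) with (M * (1 / 2) ^ n / rho)
      by (field; lra).
    apply Rle_div_r; [assumption|]. eapply Rle_trans; [|apply Hc].
    apply derived_term_le. lra. }
  assert (Hex : exists D : C, C_series t D).
  { apply (@ex_series_le C_AbsRing C_CompleteNormedModule t
             (fun n => M / rho * (1 / 2) ^ n) Ht).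
    eexists. apply is_series_half_geom. }
  destruct Hex as [D HD].
  rewrite (C_series_derivative c F rho M z D Hrho Hz HF Hc HD).
  apply C_psum_series, (is_series_ext (fun n => t (S n))).
  - intros n. change (t (S n) = z ^ n * (INR (S n) * c (S n)))%C.
    unfold t. simpl pred. ring.
  - apply (is_series_incr_1 t).
    change (C_series t (D + t 0%nat)%C).
    replace (D + t 0%nat)%C with D; [exact HD|]. unfold t. simpl. ring.
Qed.

(** * The complex exponential *)

Definition real_bigO (n : nat) (f : R -> R) : Prop :=
  exists K : R, 0 <= K /\ forall x, Rabs x <= 1 -> Rabs (f x) <= K * Rabs x ^ n.

Lemma real_bigO_antiderivative (n : nat) (f df : R -> R) :
  f 0 = 0 -> (forall x, is_derive f x (df x)) -> real_bigO n df -> real_bigO (S n) f.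
Proof.
  intros f0 Hf (K & HK & Hdf). exists K. split; [assumption|]. intros x Hx.
  destruct (MVT_gen f 0 x df) as (c & Hc & E).
  - intros y _. apply Hf.
  - intros y _. apply continuity_pt_filterlim.
    apply (ex_derive_continuous (V := R_NormedModule)). exists (df y). apply Hf.
  - assert (Hcx : Rabs c <= Rabs x).
    { destruct (Rle_or_lt 0 x) as [H|H].
      - rewrite Rmin_left, Rmax_right in Hc by lra. rewrite !Rabs_pos_eq; lra.
      - rewrite Rmin_right, Rmax_left in Hc by lra. rewrite !Rabs_left1; lra. }
    replace (f x) with (df c * x) by (rewrite f0 in E; lra).
    rewrite Rabs_mult, <- tech_pow_Rmult, (Rmult_comm (Rabs x)), <- Rmult_assoc.
    apply Rmult_le_compat_r; [apply Rabs_pos|].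
    eapply Rle_trans; [apply Hdf; lra|].
    apply Rmult_le_compat_l; [assumption|].
    apply pow_incr. split; [apply Rabs_pos | assumption].
Qed.

Ltac integrate_bigO df :=
  apply (real_bigO_antiderivative _ _ df);
  [ rewrite ?exp_0, ?sin_0, ?cos_0; field
  | intros x; auto_derive; [trivial | field] | ].

Lemma exp_le_compat (x y : R) : x <= y -> exp x <= exp y.
Proof. intros [H| ->]; [left; now apply exp_increasing | lra]. Qed.

Lemma exp_bigO3 : real_bigO 3 (fun x => exp x - (1 + x + x ^ 2 / 2)).
Proof.
  integrate_bigO (fun x => exp x - (1 + x)).
  integrate_bigO (fun x => exp x - 1).
  integrate_bigO exp.
  exists 3. split; [lra|]. intros x Hx. apply Rabs_le_between in Hx.
  rewrite Rabs_pos_eq by (left; apply exp_pos).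
  assert (exp x <= exp 1) by (apply exp_le_compat; lra).
  generalize exp_le_3. simpl. lra.
Qed.

Lemma sin_bigO3 : real_bigO 3 (fun x => sin x - x).
Proof.
  integrate_bigO (fun x => cos x - 1).
  integrate_bigO (fun x => - sin x).
  integrate_bigO (fun x => - cos x).
  exists 1. split; [lra|]. intros x _. rewrite Rabs_Ropp. simpl. rewrite Rmult_1_r.
  apply Rabs_le, COS_bound.
Qed.

Lemma cos_bigO3 : real_bigO 3 (fun x => cos x - (1 - x ^ 2 / 2)).
Proof.
  integrate_bigO (fun x => - (sin x - x)).
  integrate_bigO (fun x => - (cos x - 1)).
  integrate_bigO sin.
  exists 1. split; [lra|]. intros x _. simpl. rewrite Rmult_1_r.
  apply Rabs_le, SIN_bound.
Qed.

Lemma Cmod_le_Rabs (x y : R) : Cmod (x, y) <= Rabs x + Rabs y.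
Proof.
  replace (x, y) with (x + Ci * y)%C by (apply injective_projections; simpl; ring).
  eapply Rle_trans; [apply Cmod_triangle|].
  rewrite Cmod_mult, Cmod_Ci, !Cmod_R. lra.
Qed.

Lemma Cmod_cos_sin (y : R) : Cmod (cos y, sin y) = 1.
Proof.
  unfold Cmod. simpl fst. simpl snd. rewrite <- sqrt_1. f_equal.
  generalize (sin2_cos2 y). unfold Rsqr. lra.
Qed.

Lemma real_bigO_monotone (n : nat) (f : R -> R) :
  real_bigO n f ->
  exists K : R, 0 <= K /\
    forall x m, Rabs x <= m -> m <= 1 -> Rabs (f x) <= K * m ^ n.
Proof.
  intros (K & HK & Hf). exists K. split; [assumption|]. intros x m Hx Hm.
  eapply Rle_trans; [apply Hf; lra|]. apply Rmult_le_compat_l; [assumption|].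
  apply pow_incr. split; [apply Rabs_pos | assumption].
Qed.

(* With [T] the quadratic Taylor polynomial of exp, this is
   [T(x) T(iy) - T(x + iy)]. *)
Lemma exp_taylor_cross_terms_le (x y m : R) :
  Rabs x <= m -> Rabs y <= m -> m <= 1 ->
  Cmod (- (x * (1 + x / 2) * y ^ 2 / 2), x ^ 2 * y / 2) <= 5 / 4 * m ^ 3.
Proof.
  intros Hx Hy Hm. assert (Hx1 : Rabs x <= 1) by lra. apply Rabs_le_between in Hx1.
  assert (Hcubic : forall u v w : R, Rabs u <= m -> Rabs v <= m -> Rabs w <= m ->
    Rabs (u * v * w) <= m ^ 3).
  { intros u v w Hu Hv Hw. rewrite !Rabs_mult.
    replace (m ^ 3) with (m * m * m) by ring.
    apply Rmult_le_compat; auto using Rmult_le_pos, Rabs_pos.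
    apply Rmult_le_compat; auto using Rabs_pos. }
  assert (Hre : Rabs (- (x * (1 + x / 2) * y ^ 2 / 2)) <= 3 / 4 * m ^ 3).
  { replace (- (x * (1 + x / 2) * y ^ 2 / 2))
      with (- ((1 + x / 2) / 2) * (x * y * y)) by field.
    rewrite Rabs_mult, Rabs_Ropp, (Rabs_pos_eq ((1 + x / 2) / 2)) by lra.
    apply Rmult_le_compat; auto using Rabs_pos; lra. }
  assert (Him : Rabs (x ^ 2 * y / 2) <= 1 / 2 * m ^ 3).
  { replace (x ^ 2 * y / 2) with (1 / 2 * (x * x * y)) by field.
    rewrite Rabs_mult, Rabs_pos_eq by lra. apply Rmult_le_compat_l; auto; lra. }
  eapply Rle_trans; [apply Cmod_le_Rabs | lra].
Qed.

Lemma Cexp_cubic_error :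
  exists K : R, forall z : C, Cmod z <= 1 ->
    Cmod (Cexp z - (1 + z * (1 + z * / 2))) <= K * Cmod z ^ 3.
Proof.
  destruct (real_bigO_monotone _ _ exp_bigO3) as (K1 & HK1 & Hexp).
  destruct (real_bigO_monotone _ _ cos_bigO3) as (K2 & HK2 & Hcos).
  destruct (real_bigO_monotone _ _ sin_bigO3) as (K3 & HK3 & Hsin).
  exists (K1 + 5 / 2 * (K2 + K3) + 5 / 4). intros [x y] Hm.
  assert (Hxy := Rmax_Cmod (x, y)). simpl in Hxy. set (m := Cmod (x, y)) in *.
  assert (Hx : Rabs x <= m) by (eapply Rle_trans; [apply Rmax_l | exact Hxy]).
  assert (Hy : Rabs y <= m) by (eapply Rle_trans; [apply Rmax_r | exact Hxy]).
  specialize (Hexp x m Hx Hm). specialize (Hcos y m Hy Hm). specialize (Hsin y m Hy Hm).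
  set (exp_err := exp x - (1 + x + x ^ 2 / 2)) in *.
  set (cos_err := cos y - (1 - y ^ 2 / 2)) in *. set (sin_err := sin y - y) in *.
  set (p := 1 + x + x ^ 2 / 2) in *.
  replace (Cexp (x, y) - (1 + (x, y) * (1 + (x, y) * / 2)))%C
    with (exp_err * (cos y, sin y) + p * (cos_err, sin_err)
          + (- (x * (1 + x / 2) * y ^ 2 / 2), x ^ 2 * y / 2)%R)%C
    by (unfold exp_err, cos_err, sin_err, p, Cexp;
        apply injective_projections; simpl; field).
  eapply Rle_trans; [apply Cmod_triangle|].
  eapply Rle_trans; [apply Rplus_le_compat_r, Cmod_triangle|].
  rewrite !Cmod_mult, !Cmod_R, Cmod_cos_sin, Rmult_1_r.
  assert (Hcross := exp_taylor_cross_terms_le x y m Hx Hy Hm).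
  assert (Hcis := Cmod_le_Rabs cos_err sin_err).
  assert (Hp : Rabs p <= 5 / 2).
  { assert (Hx1 : Rabs x <= 1) by lra. apply Rabs_le_between in Hx1.
    unfold p. apply Rabs_le. nra. }
  assert (Rabs p * Cmod (cos_err, sin_err) <= 5 / 2 * ((K2 + K3) * m ^ 3))
    by (apply Rmult_le_compat; [apply Rabs_pos | apply Cmod_ge_0 | assumption | lra]).
  lra.
Qed.

Lemma jet2_of_cubic_error (F : C -> C) (c0 c1 c2 : C) (K : R) :
  near0 (fun z => Cmod (F z - (c0 + z * (c1 + z * c2))) <= K * Cmod z ^ 3) ->
  jet2 F c0 c1 c2.
Proof.
  intros HF. apply bounded_quotient in HF. destruct HF as (G & BG & HG).
  exists G. split; [assumption|]. revert HG. apply near0_imp. intros z E.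
  transitivity (F z - (c0 + z * (c1 + z * c2)) + (c0 + z * (c1 + z * c2)))%C; [ring|].
  rewrite E. simpl. ring.
Qed.

Lemma Cexp_jet2 : jet2 Cexp 1 1 (/ 2).
Proof.
  destruct Cexp_cubic_error as [K HK]. apply (jet2_of_cubic_error _ _ _ _ K).
  apply near0_Cmod. exists 1. split; [lra|]. intros z Hz. apply HK. lra.
Qed.

(** * Positivity of Euler's integral *)

Section ImproperIntegral.

Variable f : R -> R.
Hypothesis f_continuous : forall t, 0 < t -> continuous f t.
Hypothesis f_ge_0 : forall t, 0 < t -> 0 <= f t.

Lemma ex_RInt_positive_axis (a b : R) : 0 < a -> a <= b -> ex_RInt f a b.
Proof.
  intros Ha Hab. apply (ex_RInt_continuous (V := R_CompleteNormedModule)).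
  intros t Ht. rewrite Rmin_left in Ht by lra. apply f_continuous. lra.
Qed.

Lemma RInt_le_of_interval_incl (a b a' b' : R) :
  0 < a' -> a' <= a -> a <= b -> b <= b' -> RInt f a b <= RInt f a' b'.
Proof.
  intros Ha' Ha Hab Hb.
  assert (Hge : forall x y, 0 < x -> x <= y -> 0 <= RInt f x y).
  { intros x y Hx Hxy. apply RInt_ge_0; [lra | now apply ex_RInt_positive_axis|].
    intros t Ht. apply f_ge_0. lra. }
  rewrite <- (RInt_Chasles f a' a b') by (apply ex_RInt_positive_axis; lra).
  rewrite <- (RInt_Chasles f a b b') by (apply ex_RInt_positive_axis; lra).
  assert (Hl := Hge a' a Ha' Ha). assert (Hr := Hge b b' ltac:(lra) Hb).
  unfold plus; simpl. lra.
Qed.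

Lemma is_RInt_gen_lub (S : R) :
  is_lub (fun x => exists a b, 0 < a < b /\ x = RInt f a b) S ->
  is_RInt_gen f (at_right 0) (Rbar_locally p_infty) S.
Proof.
  intros [Sub Slub]. apply filterlimi_locally. intros eps.
  assert (Hnear : exists a b, 0 < a < b /\ S - eps < RInt f a b).
  { apply NNPP. intros Hno.
    assert (S <= S - eps); [|generalize (cond_pos eps); lra].
    apply Slub. intros x (a & b & Hab & ->). apply Rnot_lt_le. intros Hlt.
    apply Hno. now exists a, b. }
  destruct Hnear as (a & b & Hab & Hlt).
  apply (Filter_prod _ _ _ (fun x => 0 < x < a) (fun y => b < y)).
  - apply filter_and; [now exists (mkposreal 1 Rlt_0_1)|].
    apply filter_le_within, open_lt. lra.
  - now exists b.
  - intros x y Hx Hy. exists (RInt f x y). split.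
    + apply (RInt_correct (V := R_CompleteNormedModule)), ex_RInt_positive_axis;
        simpl; lra.
    + assert (Hincl := RInt_le_of_interval_incl a b x y
        ltac:(lra) ltac:(lra) ltac:(lra) ltac:(lra)).
      assert (HS : RInt f x y <= S)
        by (apply Sub; exists x, y; split; [lra | reflexivity]).
      apply Rabs_lt_between'. generalize (cond_pos eps). lra.
Qed.

Lemma RInt_gen_gt_0 (M : R) :
  (forall t, 0 < t -> 0 < f t) -> (forall a b, 0 < a < b -> RInt f a b <= M) ->
  0 < RInt_gen f (at_right 0) (Rbar_locally p_infty).
Proof.
  intros f_gt_0 Hbound.
  destruct (completeness (fun x => exists a b, 0 < a < b /\ x = RInt f a b)) as [S HS].
  { exists M. intros x (a & b & Hab & ->). now apply Hbound. }
  { exists (RInt f 1 2), 1, 2. split; [lra | reflexivity]. }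
  rewrite (is_RInt_gen_unique _ _ (is_RInt_gen_lub S HS)).
  apply Rlt_le_trans with (RInt f 1 2).
  - apply RInt_gt_0; [lra | |]; intros t Ht; [apply f_gt_0 | apply f_continuous]; lra.
  - apply HS. exists 1, 2. split; [lra | reflexivity].
Qed.

End ImproperIntegral.

Lemma Rpower_le_exp_half (s : R) :
  0 <= s -> exists K : R, 0 <= K /\ forall t, 0 < t -> Rpower t s <= K * exp (t / 2).
Proof.
  intros Hs. set (c := 2 * (s + 1)). exists (exp (s * ln c)).
  split; [left; apply exp_pos|]. intros t Ht.
  assert (Hc : 0 < c) by (unfold c; lra).
  assert (Htc : 0 < t / c) by now apply Rdiv_lt_0_compat.
  assert (Hln : ln t <= t / c + ln c).
  { replace t with (t / c * c) at 1 by (field; lra).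
    rewrite ln_mult by assumption.
    assert (Hexp := exp_ineq1_le (ln (t / c))). rewrite exp_ln in Hexp; lra. }
  assert (Hstc : s * (t / c) <= t / 2).
  { apply Rle_trans with ((s + 1) * (t / c)); [nra|]. right. unfold c. field. lra. }
  unfold Rpower. rewrite <- exp_plus.
  apply (Rmult_le_compat_l s) in Hln; [|assumption].
  apply exp_le_compat. lra.
Qed.

Lemma RInt_exp_neg_half_le (a b : R) :
  0 <= a -> ex_RInt (fun t => exp (- (t / 2))) a b /\
            RInt (fun t => exp (- (t / 2))) a b <= 2.
Proof.
  intros Ha.
  assert (HI : is_RInt (fun t => exp (- (t / 2))) a b
                 (- 2 * exp (- (b / 2)) - - 2 * exp (- (a / 2)))).
  { apply (is_RInt_derive (fun t => - 2 * exp (- (t / 2)))).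
    - intros t _. auto_derive; [trivial | unfold Rdiv; field].
    - intros t _. apply (ex_derive_continuous (V := R_NormedModule)).
      auto_derive. trivial. }
  split; [eexists; exact HI|]. rewrite (is_RInt_unique _ _ _ _ HI).
  assert (Hb := exp_pos (- (b / 2))).
  assert (Ha1 : exp (- (a / 2)) <= 1).
  { rewrite <- exp_0. apply exp_le_compat. lra. }
  lra.
Qed.

Lemma Gamma_gt_0 (x : R) : 1 <= x -> 0 < Gamma x.
Proof.
  intros Hx.
  destruct (Rpower_le_exp_half (x - 1)) as (K & HK & Hpow); [lra|].
  set (g := fun t => Rpower t (x - 1) * exp (- t)).
  assert (Hcont : forall t, 0 < t -> continuous g t).
  { intros t Ht. apply (ex_derive_continuous (V := R_NormedModule)).
    unfold g, Rpower. auto_derive. assumption. }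
  assert (Hpos : forall t, 0 < t -> 0 < g t)
    by (intros t _; apply Rmult_lt_0_compat; apply exp_pos).
  apply (RInt_gen_gt_0 g Hcont (fun t Ht => Rlt_le _ _ (Hpos t Ht)) (K * 2));
    [assumption|].
  intros a b Hab. destruct (RInt_exp_neg_half_le a b) as [Hex Hle]; [lra|].
  apply Rle_trans with (RInt (fun t => scal K (exp (- (t / 2)))) a b).
  - apply RInt_le; [lra | | now apply (ex_RInt_scal (V := R_NormedModule))|].
    + apply ex_RInt_positive_axis; [exact Hcont | lra..].
    + intros t Ht. change (scal K (exp (- (t / 2)))) with (K * exp (- (t / 2))).
      replace (exp (- (t / 2))) with (exp (t / 2) * exp (- t))
        by (rewrite <- exp_plus; f_equal; field).
      unfold g. rewrite <- Rmult_assoc.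
      apply Rmult_le_compat_r; [left; apply exp_pos | apply Hpow; lra].
  - rewrite (RInt_scal (V := R_CompleteNormedModule)) by assumption.
    now apply Rmult_le_compat_l.
Qed.

Lemma Cbin_gt_0 (delta : R) (n : nat) : 0 <= delta -> (1 <= n)%nat -> 0 < Cbin delta n.
Proof.
  intros Hd Hn. assert (HINR := le_INR 1 n Hn). simpl in HINR. unfold Cbin.
  apply Rdiv_lt_0_compat; [|apply Rmult_lt_0_compat]; apply Gamma_gt_0; lra.
Qed.

(** * Coefficient estimates *)

Lemma near0_disc (r : posreal) (P : C -> Prop) :
  (forall z, Defs.disc r z -> P z) -> near0 P.
Proof. intros H. apply near0_Cmod. exists r. split; [apply cond_pos | exact H]. Qed.

Lemma near0_U (P : C -> Prop) : (forall z, U z -> P z) -> near0 P.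
Proof. exact (near0_disc (mkposreal 1 Rlt_0_1) P). Qed.

Lemma C_psum_factor (c : nat -> C) (F : C -> C) :
  near0 (fun z => C_psum c z (F z)) -> c 0%nat = 0 ->
  exists G : C -> C, jet2 G (c 1%nat) (c 2%nat) (c 3%nat) /\
    near0 (fun z => F z = z * G z)%C.
Proof.
  intros H c0. destruct (C_psum_shift c F H) as (G & HG & HF).
  exists G. split; [exact (C_psum_jet2 _ _ HG)|].
  revert HF. apply near0_imp. intros z ->. rewrite c0. ring.
Qed.

Lemma class_A_coef_unique (h : C -> C) (c d : nat -> C) :
  class_A h c -> class_A h d -> forall n, c n = d n.
Proof.
  intros (_ & _ & Hc) (_ & _ & Hd) n.
  now apply (C_psum_coef_unique n c d h h (near0_U _ Hc) (near0_U _ Hd)), near0_forall.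
Qed.

Lemma inverse_coefs (f g : C -> C) (a b : nat -> C) :
  class_A f a -> class_A g b -> extended_inverse f g ->
  b 2%nat = (- a 2%nat)%C /\ b 3%nat = (2 * (a 2%nat * a 2%nat) - a 3%nat)%C.
Proof.
  intros (a0 & a1 & Hf) (b0 & b1 & Hg) (_ & _ & r & Hinv).
  assert (fJ := C_psum_jet2 a f (near0_U _ Hf)). rewrite a0, a1 in fJ.
  destruct (jet2_continuous fJ) as [_ f_to_0].
  destruct (C_psum_factor a f (near0_U _ Hf) a0) as (p & pJ & Ef).
  destruct (C_psum_factor b g (near0_U _ Hg) b0) as (q & qJ & Eg).
  rewrite a1 in pJ. rewrite b1 in qJ.
  assert (Hsmall : near0 (fun z => Cmod (f z) < r))
    by exact (f_to_0 _ (near0_disc r _ (fun z Hz => Hz))).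
  apply f_to_0 in Eg. unfold filtermap in Eg.
  assert (Hpq : near0 (fun z => z * (p z * q (f z)) = z * 1)%C).
  { generalize (filter_and _ _ (near0_U _ (fun z Hz => Hz))
                  (filter_and _ _ Hsmall (filter_and _ _ Ef Eg))).
    apply near0_imp. intros z (Uz & Hz & Efz & Egz).
    rewrite Cmult_assoc, <- Efz, <- Egz, Hinv by assumption. ring. }
  destruct (jet2_unique_off_0 Hpq (jet2_mult pJ (jet2_comp qJ fJ)) (jet2_const 1))
    as (_ & E1 & E2).
  assert (Eb2 : b 2%nat = (- a 2%nat)%C).
  { transitivity (1 * (b 2%nat * 1) + a 2%nat * 1 - a 2%nat)%C; [ring|].
    rewrite E1. ring. }
  split; [assumption|]. rewrite Eb2 in E2.
  transitivity (1 * (- a 2%nat * a 2%nat + b 3%nat * (1 * 1))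
                + a 2%nat * (- a 2%nat * 1) + a 3%nat * 1
                + (2 * (a 2%nat * a 2%nat) - a 3%nat))%C; [ring|].
  rewrite E2. ring.
Qed.

(* [u1, u2] are the first coefficients of the Schwarz function; the left-hand
   sides are the coefficients of [z^(1-gamma) F'(z) / F(z)^(1-gamma)] for
   [F(z) = z + d2 z^2 + d3 z^3 + ...]. *)
Definition schwarz_relations (gamma : R) (b1 b2 d2 d3 u1 u2 : C) : Prop :=
  Cmod u2 <= 1 - Cmod u1 ^ 2 /\
  (RtoC (gamma + 1) * d2 = b1 * u1)%C /\
  (RtoC (gamma + 2) * d3 + RtoC ((gamma - 1) * (gamma + 2) / 2) * (d2 * d2)
   = b1 * u2 + b2 * (u1 * u1))%C.

Lemma subordinate_jet2 {F phi : C -> C} {b0 b1 b2 : C} :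
  jet2 phi b0 b1 b2 -> subordinate F phi ->
  exists u1 u2 : C, Cmod u2 <= 1 - Cmod u1 ^ 2 /\
    jet2 F b0 (b1 * u1) (b1 * u2 + b2 * (u1 * u1)).
Proof.
  intros phiJ (w & w_analytic & w0 & Hw).
  assert (Tw : forall z, Cmod z < 1 -> expandable_at w z)
    by (intros z Hz; now apply (analytic_in_expandable_at U)).
  destruct (expandable_at_0_jet2 w) as (u1 & u2 & wJ).
  { apply Tw. rewrite Cmod_0. lra. }
  rewrite w0 in wJ. exists u1, u2. split.
  - apply (schwarz_second_coef_le w); [assumption| |assumption].
    intros z Hz. left. now apply Hw.
  - apply (jet2_ext (fun z => phi (w z))); [|now apply jet2_comp].
    apply near0_U. intros z Hz. symmetry. now apply Hw.
Qed.

Lemma power_branch_jet2 {s : R} {F P D : C -> C} {d2 d3 : C} :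
  power_branch s F P -> near0 (fun z => F z = z * D z)%C -> jet2 D 1 d2 d3 ->
  jet2 P 1 (s * d2) (s * d3 + RtoC (s * (s - 1) / 2) * (d2 * d2)).
Proof.
  intros (_ & r & L & L_analytic & L0 & HFP) EF DJ.
  destruct (expandable_at_0_jet2 L) as (l1 & l2 & LJ).
  { apply (analytic_in_expandable_at (Defs.disc r)); [assumption|].
    unfold Defs.disc. rewrite Cmod_0. apply cond_pos. }
  rewrite L0 in LJ.
  assert (EDL : near0 (fun z => z * D z = z * Cexp (L z))%C).
  { generalize (filter_and _ _ EF (near0_disc r _ HFP)). apply near0_imp.
    now intros z (<- & <- & _). }
  destruct (jet2_unique_off_0 EDL DJ (jet2_comp Cexp_jet2 LJ)) as (_ & E2 & E3).
  apply (jet2_ext (fun z => Cexp (s * L z))).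
  { apply (near0_disc r). intros z Hz. symmetry. now apply HFP. }
  assert (sLJ := jet2_scal s LJ). rewrite Cmult_0_r in sLJ.
  generalize (jet2_comp Cexp_jet2 sLJ).
  rewrite E2, E3, RtoC_div, RtoC_mult, RtoC_minus by lra.
  apply jet2_eq; [reflexivity| |]; field.
Qed.

Lemma power_quotient_relations (gamma : R) (F phi : C -> C) (d B : nat -> C) :
  d 0%nat = 0 -> d 1%nat = 1 -> (forall z, U z -> C_psum d z (F z)) ->
  (forall z, U z -> C_psum B z (phi z)) ->
  power_quotient_subordinate gamma F phi ->
  exists u1 u2 : C,
    schwarz_relations gamma (B 1%nat) (B 2%nat) (d 2%nat) (d 3%nat) u1 u2.
Proof.
  intros d0 d1 HF Hphi (P & HP & Hsub).
  destruct (C_psum_factor d F (near0_U _ HF) d0) as (D & DJ & EF). rewrite d1 in DJ.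
  assert (PJ := power_branch_jet2 HP EF DJ).
  assert (F'J := C_psum_jet2 _ _ (C_psum_derive d F (near0_U _ HF))).
  destruct (subordinate_jet2 (C_psum_jet2 B phi (near0_U _ Hphi)) Hsub)
    as (u1 & u2 & Hu & HJ).
  destruct (jet2_unique HJ (jet2_mult F'J PJ)) as (_ & E1 & E2).
  exists u1, u2. split; [assumption|]. rewrite E1, E2, d1. simpl INR.
  split; rewrite ?RtoC_div, ?RtoC_mult, ?RtoC_minus, ?RtoC_plus by lra; field.
Qed.

Section CoefficientBounds.

Context {gamma B1 T2 T3 : R} {b2 x y u1 u2 v1 v2 : C}.
Hypothesis B1_gt_0 : 0 < B1.
Hypothesis relations_f :
  schwarz_relations gamma B1 b2 (T2 * x) (T3 * y) u1 u2.
Hypothesis relations_g :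
  schwarz_relations gamma B1 b2 (T2 * - x) (T3 * (2 * (x * x) - y)) v1 v2.

Definition second_coef_denominator : C :=
  (RtoC (B1 ^ 2 * (2 * (gamma + 2) * T3 + (gamma - 1) * (gamma + 2) * T2 ^ 2))
   - RtoC 2 * (b2 - RtoC B1) * RtoC ((gamma + 1) ^ 2 * T2 ^ 2))%C.

Lemma schwarz_coefs_opposite : v1 = (- u1)%C.
Proof.
  destruct relations_f as (_ & Ef & _), relations_g as (_ & Eg & _).
  assert (HB1 : RtoC B1 <> 0) by (apply Cmod_gt_0; rewrite Cmod_R, Rabs_pos_eq; lra).
  replace v1 with (/ B1 * (B1 * v1))%C by now field.
  replace u1 with (/ B1 * (B1 * u1))%C by now field.
  rewrite <- Ef, <- Eg. ring.
Qed.

Lemma schwarz_coefs_sq_sum_le :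
  Cmod u2 <= 1 - Cmod u1 ^ 2 /\ Cmod v2 <= 1 - Cmod u1 ^ 2.
Proof.
  destruct relations_f as [Hf _], relations_g as [Hg _].
  rewrite schwarz_coefs_opposite, Cmod_opp in Hg. tauto.
Qed.

Lemma second_coef_identity :
  (second_coef_denominator * (x * x)
   = RtoC (B1 ^ 3) * (u2 + v2 + 2 * (u1 * u1)))%C.
Proof.
  destruct relations_f as (_ & E1 & Ef), relations_g as (_ & _ & Eg).
  rewrite schwarz_coefs_opposite in Eg.
  transitivity (B1 * B1 * ((B1 * u2 + b2 * (u1 * u1)) + (B1 * v2 + b2 * (- u1 * - u1)))
                + 2 * (B1 - b2) * ((B1 * u1) * (B1 * u1)))%C.
  - rewrite <- E1, <- Ef, <- Eg. unfold second_coef_denominator.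
    repeat rewrite ?RtoC_div, ?RtoC_minus, ?RtoC_mult, ?RtoC_pow, ?RtoC_plus by lra.
    field.
  - rewrite RtoC_pow. ring.
Qed.

Lemma third_coef_identity :
  (2 * (RtoC ((gamma + 2) * T3) * (y - x * x)) = B1 * (u2 - v2))%C.
Proof.
  destruct relations_f as (_ & _ & Ef), relations_g as (_ & _ & Eg).
  rewrite schwarz_coefs_opposite in Eg.
  transitivity ((B1 * u2 + b2 * (u1 * u1)) - (B1 * v2 + b2 * (- u1 * - u1)))%C; [|ring].
  rewrite <- Ef, <- Eg, RtoC_mult. ring.
Qed.

Lemma second_coef_le :
  second_coef_denominator <> 0 ->
  Cmod x <= B1 * sqrt (2 * B1) / sqrt (Cmod second_coef_denominator).
Proof.
  intros HE. apply Cmod_gt_0 in HE.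
  assert (Hsum : Cmod (u2 + v2 + 2 * (u1 * u1)) <= 2).
  { destruct schwarz_coefs_sq_sum_le as [Hu Hv].
    assert (Htri := Cmod_triangle (u2 + v2) (2 * (u1 * u1))).
    assert (Htri' := Cmod_triangle u2 v2).
    rewrite !Cmod_mult, Cmod_R_pos_eq in Htri by lra. lra. }
  assert (Hsq : Cmod x ^ 2 * Cmod second_coef_denominator <= B1 ^ 3 * 2).
  { assert (E := f_equal Cmod second_coef_identity).
    rewrite !Cmod_mult, Cmod_R, Rabs_pos_eq in E by (apply pow_le; lra).
    replace (Cmod x ^ 2 * Cmod second_coef_denominator)
      with (Cmod second_coef_denominator * (Cmod x * Cmod x)) by ring.
    rewrite E. apply Rmult_le_compat_l; [apply pow_le; lra | assumption]. }
  assert (Hsqrt : 0 < sqrt (Cmod second_coef_denominator)) by now apply sqrt_lt_R0.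
  apply -> Rle_div_r; [|assumption].
  apply Rsqr_incr_0_var.
  - rewrite !Rsqr_pow2, !Rpow_mult_distr, !pow2_sqrt by lra. lra.
  - apply Rmult_le_pos; [lra | apply sqrt_pos].
Qed.

Lemma second_coef_le_of_first_relation :
  0 < (gamma + 1) * T2 -> Cmod x <= B1 / ((gamma + 1) * T2).
Proof.
  intros Hpos. destruct relations_f as (Hu & E & _).
  assert (Hu1 : Cmod u1 <= 1).
  { assert (u2_ge_0 := Cmod_ge_0 u2). nra. }
  apply -> Rle_div_r; [|assumption].
  rewrite Cmult_assoc, <- RtoC_mult in E. apply (f_equal Cmod) in E.
  rewrite !Cmod_mult, !Cmod_R, !Rabs_pos_eq in E by lra.
  rewrite Rmult_comm, E. rewrite <- (Rmult_1_r B1) at 2.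
  apply Rmult_le_compat_l; lra.
Qed.

Lemma third_coef_le :
  0 < (gamma + 1) * T2 -> 0 < (gamma + 2) * T3 ->
  Cmod y <= B1 / ((gamma + 2) * T3) + (B1 / ((gamma + 1) * T2)) ^ 2.
Proof.
  intros HT2 HT3.
  assert (Hyx : Cmod (y - x * x) <= B1 / ((gamma + 2) * T3)).
  { destruct schwarz_coefs_sq_sum_le as [Hu Hv].
    assert (Htri := Cmod_triangle u2 (- v2)). rewrite Cmod_opp in Htri.
    assert (u1_sq_ge_0 := pow2_ge_0 (Cmod u1)).
    assert (E := f_equal Cmod third_coef_identity).
    rewrite !Cmod_mult, !Cmod_R, !Rabs_pos_eq in E by lra.
    apply -> Rle_div_r; [|assumption].
    assert (B1 * Cmod (u2 - v2) <= B1 * 2)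
      by (apply Rmult_le_compat_l; unfold Cminus; lra).
    lra. }
  replace y with ((y - x * x) + x * x)%C by ring.
  eapply Rle_trans; [apply Cmod_triangle|]. apply Rplus_le_compat; [assumption|].
  replace (Cmod (x * x)) with (Cmod x ^ 2) by (rewrite Cmod_mult; ring).
  apply pow_incr. split; [apply Cmod_ge_0 | now apply second_coef_le_of_first_relation].
Qed.

End CoefficientBounds.

Lemma Upsilon_2_gt_0 (alpha beta lambda : R) (k : nat) :
  0 < Upsilon alpha beta lambda k 3 -> 0 < Upsilon alpha beta lambda k 2.
Proof.
  unfold Upsilon. intros H.
  replace (lambda * (alpha + beta - 1) * (INR 3 - 1))
    with (2 * (lambda * (alpha + beta - 1) * (INR 2 - 1))) in H by (simpl; ring).
  rewrite Rpow_mult_distr in H.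
  apply (Rmult_lt_reg_l (2 ^ k)); [apply pow_lt|]; lra.
Qed.

Theorem theorem2p1
  (k : nat) (alpha beta lambda delta gamma : R)
  (halpha : 0 < alpha <= 1) (hbeta : 0 < beta <= 1)
  (hlambda : 0 <= lambda) (hdelta : 0 <= delta) (hgamma : 0 <= gamma)
  (phi : C -> C) (B : nat -> C) (B1 : R)
  (hphi : forall z : C, U z -> C_psum B z (phi z))
  (hB0 : B 0%nat = RtoC 1) (hB1 : B 1%nat = RtoC B1) (hB1pos : 0 < B1)
  (f : C -> C) (a : nat -> C)
  (hf : class_A f a)
  (hmem : class_B k alpha beta delta lambda gamma phi f) :
  let T2 := Upsilon alpha beta lambda k 2 * Cbin delta 2 in
  let T3 := Upsilon alpha beta lambda k 3 * Cbin delta 3 in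
  let E : C :=
    (RtoC (B1 ^ 2 * (2 * (gamma + 2) * T3
                     + (gamma - 1) * (gamma + 2) * T2 ^ 2))
     - RtoC 2 * (B 2%nat - RtoC B1) * RtoC ((gamma + 1) ^ 2 * T2 ^ 2))%C in
  (E <> RtoC 0 -> Cmod (a 2%nat) <= B1 * sqrt (2 * B1) / sqrt (Cmod E)) /\
  (0 < Upsilon alpha beta lambda k 3 ->
     Cmod (a 3%nat) <= B1 / ((gamma + 2) * T3) + (B1 / ((gamma + 1) * T2)) ^ 2).
Proof.
  intros T2 T3 E.
  destruct hmem as (_ & g & Df & Dg & g_inverse & (af & Haf & HDf) & (bg & Hbg & HDg)
                    & f_quotient & g_quotient).
  destruct (inverse_coefs f g af bg Haf Hbg g_inverse) as [Eb2 Eb3].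
  assert (Ea := class_A_coef_unique f af a Haf hf).
  destruct (power_quotient_relations gamma Df phi _ B eq_refl eq_refl HDf hphi f_quotient)
    as (u1 & u2 & relations_f).
  destruct (power_quotient_relations gamma Dg phi _ B eq_refl eq_refl HDg hphi g_quotient)
    as (v1 & v2 & relations_g).
  simpl D_coef in relations_f, relations_g.
  rewrite hB1, !Ea in relations_f. rewrite hB1, Eb2, Eb3, !Ea in relations_g.
  split.
  - exact (second_coef_le hB1pos relations_f relations_g).
  - intros U3_gt_0. assert (U2_gt_0 := Upsilon_2_gt_0 _ _ _ _ U3_gt_0).
    assert (T2_gt_0 : 0 < T2) by (apply Rmult_lt_0_compat; auto using Cbin_gt_0).
    assert (T3_gt_0 : 0 < T3) by (apply Rmult_lt_0_compat; auto using Cbin_gt_0).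
    apply (third_coef_le hB1pos relations_f relations_g);
      apply Rmult_lt_0_compat; assumption || lra.
Qed.
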